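(* Let $\beta>0$ be a real number and let $f\in\mathcal{F}^3$. Let $Z$ be a standard normal random variable. Then for every positive integer $n$ and all independent random variables $X_1,\dots,X_n$ such that $$\mathsf{E} X_i\le 0\ \text{ for all } i,\qquad \sum_{i=1}^n\mathsf{E} X_i^2\le 1,\qquad \sum_{i=1}^n\mathsf{E}(X_i)_+^3\le\beta,$$ the sum $S:=X_1+\dots+X_n$ satisfies $$\mathsf{E} f(S)\le \mathsf{E} f(Z)+\frac{f'''(\infty-)}{3!}\,\beta.$$ Moreover, for each $f\in\mathcal{F}^3$ (and each $\beta>0$) this upper bound is exact, in the sense that the right-hand side of the inequality equals the supremum of $\mathsf{E} f(S)$ over all (finite families of) independent random variables $X_i$ satisfying the three displayed conditions.
   Context: Notation: $x_+:=\max(0,x)$ and $x_+^p:=(x_+)^p$ for real $x$ and real $p>0$. $\mathcal{F}^3$ is the class of all twice continuously differentiable functions $f\colon\mathbb{R}\to\mathbb{R}$ such that both $f$ and $f''$ are nondecreasing and convex. For $f\in\mathcal{F}^3$, $f'''$ denotes the right derivative of the convex function $f''$; it is nondecreasing and nonnegative, and $f'''(\infty-):=\lim_{x\to\infty}f'''(x)\in[0,\infty]$. Equivalently, $\mathcal{F}^3$ is the class of $f\in C^2$ for which $f,f',f'',f'''$ are all nondecreasing. For $f\in\mathcal{F}^3$ and any random variable $X$ with finite expectation, $\mathsf{E} f(X)$ exists in $(-\infty,\infty]$, because $f$ is convex. The inequality is understood in $(-\infty,\infty]$; when $f'''(\infty-)=\infty$ the right-hand side is $\infty$. The number $n$ of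 summands is arbitrary and is not fixed in the supremum. *)

(* Defs.v *)
(* MathComp / MathComp-Analysis *)
From mathcomp Require Export all_boot all_order all_algebra.
From mathcomp Require Export all_classical all_reals all_analysis.
Export Order.TTheory GRing.Theory Num.Theory.
Export numFieldNormedType.Exports.

Set Implicit Arguments.
Unset Strict Implicit.
Unset Printing Implicit Defensive.

Local Open Scope classical_set_scope.
Local Open Scope ring_scope.

(* As an element of R this is meaningful only where the one-sided limit exists,
   which for a convex g is everywhere. *)
Definition right_derivative (R : realType) (g : R -> R) (x : R) : R :=
  lim (h^-1 * (g (x + h) - g x) @[h --> 0^'+]).

Record classF3 (R : realType) (f : R -> R) : Prop := ClassF3 {
  F3_derivable : forall x, derivable f x 1;
  F3_derivable' : forall x, derivable (derive1 f) x 1;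
  F3_continuous'' : continuous (derive1n 2 f : R -> R);
  F3_nondecreasing : {homo f : x y / x <= y};
  F3_nondecreasing'' : {homo derive1n 2 f : x y / x <= y};
  F3_convex : convex_function ([set: R] : set R^o) f;
  F3_convex'' : convex_function ([set: R] : set R^o) (derive1n 2 f) }.

(* f''' is the right derivative of f''; on the class above it is nondecreasing,
   so the limit exists in [0, +oo]. *)
Definition f'''_at_infty (R : realType) (f : R -> R) : \bar R :=
  lim ((right_derivative (derive1n 2 f) x)%:E @[x --> +oo%R]).

Definition mutually_independent (R : realType) (d : measure_display)
    (T : measurableType d) (P : probability T R) (I : finType)
    (X : I -> {RV P >-> R}) : Prop :=
  forall (J : {set I}) (A : I -> set R), (forall i, measurable (A i)) ->
    P (\bigcap_(i in [set` J]) (X i @^-1` A i)) =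
    (\prod_(i in J) P (X i @^-1` A i))%E.

(* Equality of laws is required on Borel sets only: the values of a library
   measure on non-measurable sets carry no information. *)
Definition standard_normal (R : realType) (d : measure_display)
    (T : measurableType d) (P : probability T R) (Z : {RV P >-> R}) : Prop :=
  forall A : set R, measurable A -> distribution P Z A = normal_prob 0 1 A.

(* The second-moment bound forces every X i to be square-integrable, so the
   expectations in the first condition are those of integrable variables. *)
Definition admissible (R : realType) (beta : R) (d : measure_display)
    (T : measurableType d) (P : probability T R) (n : nat)
    (X : 'I_n -> {RV P >-> R}) : Prop :=
  [/\ mutually_independent X,
      forall i, ('E_P[X i] <= 0)%E,
      (\sum_(i < n) 'E_P[fun w => (X i w ^+ 2)%R] <= 1)%E &
      (\sum_(i < n) 'E_P[fun w => (Num.max 0 (X i w) ^+ 3)%R] <= beta%:E)%E].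

(* Main.v *)
Require Import Defs.
From mathcomp Require Import ring lra measurable_realfun bernoulli_distribution.

Set Implicit Arguments.
Unset Strict Implicit.
Unset Printing Implicit Defensive.
Local Open Scope classical_set_scope.
Local Open Scope ring_scope.

(* Upper bound (Lindeberg).  If c bounds f''', then
     f(s + x) <= f(s) + f'(s) x + f''(s) x^2 / 2 + c x_+^3 / 6,
   whereas f(s + y) + f(s - y) >= 2 f(s) + f''(s) y^2 because f'' is convex.
   Hence replacing X_i by a centred normal variable of variance E X_i^2 lowers
   E f(S) by at most c E (X_i)_+^3 / 6; the terms f'(s) E X_i are nonpositive.
   Replacing the summands one at a time leaves a centred normal variable of
   variance at most 1, and E f increases with that variance.

   Exactness.  For b < beta take one variable equal to a with probability
   p = b / a^3 and to a small negative constant otherwise, together with n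
   normal variables of total variance close to 1, where n is so large that
   their positive third moments are negligible.  As a tends to infinity the
   jump has vanishing variance but contributes p f(a), which is asymptotically
   at least b f'''(x0) / 6 for every x0, and the rest tends to E f(Z). *)

(** * Third-order convex functions *)

(** The obstacle is integrability: [f] may grow so fast that E f(S) is +oo. Everything is therefore
    carried out for [tilt], which is [f] minus its tangent at 0. It is nonnegative, so its
    expectations live in [0, +oo] and Tonelli applies freely; the removed affine part has a finite
    expectation and is added back once. In the upper bound no normal copies of the summands are
    constructed: a replaced summand is absorbed into the time parameter of the Gaussian averages
    [heat], and the semigroup law does the bookkeeping. In the exactness part, b stays strictly
    below beta because the normal variables have a positive third moment, paid out of the
    difference. The Gaussian part is controlled not by dominated convergence but by a convexity
    inequality, [tilt_shrink], whose error after integration is a constant divided by a. When f'''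
    is unbounded that constant may be infinite; the jump alone is then used, and it already makes
    the expectation arbitrarily large. *)

Lemma second_derivative_ge0_le (R : realType) (g g1 g2 : R -> R) :
  (forall x : R, is_derive x (1:R) g (g1 x)) ->
  (forall x : R, is_derive x (1:R) g1 (g2 x)) ->
  (forall t, 0 <= t <= 1 -> 0 <= g2 t) -> g 0 + g1 0 <= g 1.
Proof.
move=> dg dg1 g2_ge0.
have cts (u v : R -> R) : (forall x : R, is_derive x (1:R) u (v x)) ->
    forall a b : R, {within `[a, b], continuous u}.
  move=> du a b; apply: continuous_subspaceT => x.
  by apply/differentiable_continuous/derivable1_diffP; have [] := du x.
(* Two mean value steps stand in for the integral remainder of Taylor's formula: [g 1 - g 0 = g1 c]
   and [g1 c - g1 0 = g2 d * c]. *)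
have [c] := MVT_segment ler01 (fun x _ => dg x) (cts _ _ dg _ _).
rewrite in_itv/= => /andP[c0 c1] gc.
have [d] := MVT_segment c0 (fun x _ => dg1 x) (cts _ _ dg1 _ _).
rewrite in_itv/= => /andP[d0 d1] g1c.
have := g2_ge0 d; rewrite d0 (le_trans d1 c1) => /(_ isT) g2d.
have := mulr_ge0 g2d c0; nra.
Qed.

Lemma convex_function_ineq (R : realType) (g : R -> R) :
  convex_function ([set: R] : set R^o) g ->
  forall t x y, 0 <= t <= 1 ->
    g (t * x + (1 - t) * y) <= t * g x + (1 - t) * g y.
Proof.
move=> cg t x y /andP[t0 t1].
have t01' : Itv.spec (@Itv.num_sem R) (Itv.Real `[0%Z, 1%Z]) t.
  by rewrite /= /Itv.num_sem/= in_itv/= realE t0 t1.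
by have := cg (Itv.mk t01') x y; rewrite !inE; apply.
Qed.

Lemma convex_function_mid (R : realType) (g : R -> R) (x y : R) :
  convex_function ([set: R] : set R^o) g -> 2 * g x <= g (x + y) + g (x - y).
Proof.
move=> /convex_function_ineq /(_ (1/2) (x + y) (x - y)).
have -> : 1 / 2 * (x + y) + (1 - 1 / 2) * (x - y) = x by field.
have h : 0 <= (1 / 2 : R) <= 1 by apply/andP; split; lra.
move=> /(_ h); lra.
Qed.

Lemma convex_slope_homo (R : realType) (g : R -> R) (x y z : R) :
  convex_function ([set: R] : set R^o) g -> x < y -> y < z ->
  (z - x) * g y <= (z - y) * g x + (y - x) * g z.
Proof.
move=> /convex_function_ineq cg xy yz.
have zx : 0 < z - x by lra.
have := cg ((z - y) / (z - x)) x z.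
have -> : (z - y) / (z - x) * x + (1 - (z - y) / (z - x)) * z = y.
  by field; rewrite gt_eqF.
have h : 0 <= (z - y) / (z - x) <= 1.
  by rewrite divr_ge0 /= ?ler_pdivrMr //; lra.
move=> /(_ h).
have -> : (z - y) / (z - x) * g x + (1 - (z - y) / (z - x)) * g z =
   ((z - y) * g x + (y - x) * g z) / (z - x).
  by field; rewrite gt_eqF.
by rewrite ler_pdivlMr // mulrC.
Qed.

(** For convex [g] the quotients [k z h] increase with [h] and lie above every slope to the left of
    [z]. Hence the limit defining the right derivative exists and is their infimum, and it lies
    between the left and the right slopes. *)
Lemma right_derivative_slope (R : realType) (g : R -> R) (x y : R) :
  convex_function ([set: R] : set R^o) g -> x < y ->
  right_derivative g x * (y - x) <= g y - g x /\
  g y - g x <= right_derivative g y * (y - x).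
Proof.
move=> cg.
pose k (z h : R) := h^-1 * (g (z + h) - g z).
have kle z h1 h2 : 0 < h1 -> h1 <= h2 -> k z h1 <= k z h2.
  move=> h1_gt0; rewrite le_eqVlt => /predU1P[->//|h12].
  have h2_gt0 : 0 < h2 by lra.
  have := @convex_slope_homo _ g z (z + h1) (z + h2) cg.
  rewrite ltrDl ltrD2l => /(_ h1_gt0 h12) H.
  rewrite /k ler_pdivrMl // mulrA mulrC mulrA ler_pdivlMr //; nra.
have low z w h : w < z -> 0 < h -> (g z - g w) / (z - w) <= k z h.
  move=> wz h0.
  have := @convex_slope_homo _ g w z (z + h) cg wz.
  rewrite ltrDl => /(_ h0) H.
  have zw : 0 < z - w by lra.
  rewrite /k ler_pdivrMr // mulrAC -mulrA ler_pdivlMl //; nra.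
have cvgk z : k z h @[h --> 0^'+] --> inf (k z @` [set` `]0, +oo[]).
  apply: nondecreasing_at_right_cvgr => //.
    move=> h1 h2; rewrite !in_itv/= !andbT => h10 _ h12; exact: kle.
  exists ((g z - g (z - 1)) / (z - (z - 1))) => _ [h + <-].
  by rewrite /= in_itv/= andbT => h0; apply: low => //; lra.
have qE z : right_derivative g z = inf (k z @` [set` `]0, +oo[]).
  by apply/cvg_lim; [exact: Rhausdorff|exact: cvgk].
have qle z h : 0 < h -> right_derivative g z <= k z h.
  move=> h0; rewrite qE; apply: ge_inf; last first.
    by exists h => //=; rewrite in_itv/= h0.
  exists ((g z - g (z - 1)) / (z - (z - 1))) => _ [h' + <-].
  by rewrite /= in_itv/= andbT => h0'; apply: low => //; lra.
have leq z w : w < z -> (g z - g w) / (z - w) <= right_derivative g z.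
  move=> wz; rewrite qE; apply: lb_le_inf.
    by exists (k z 1), 1 => //=; rewrite in_itv/= ltr01.
  by move=> _ [h' + <-]; rewrite /= in_itv/= andbT => h0'; apply: low.
move=> xy; have xy0 : 0 < y - x by lra.
split.
  by have := qle x _ xy0; rewrite /k subrKC mulrC ler_pdivlMr.
by rewrite -ler_pdivrMr //; exact: leq.
Qed.

Lemma comp_affine_is_derive (R : realType) (a b : R) (u u' : R -> R) :
  (forall x : R, is_derive x (1:R) u (u' x)) ->
  forall t : R, is_derive t (1:R) (fun t => u (a + t * b)) (u' (a + t * b) * b).
Proof.
move=> du t.
have daff : is_derive t (1:R) (fun t : R => a + t * b) b.
  apply: is_derive_eq.
  by rewrite scaler0 !add0r mul1r /GRing.scale /= mulr1.
have := @is_derive1_comp _ u (fun t => a + t * b) t _ _ (du (a + t * b)) daff.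
by rewrite /comp.
Qed.

(* The second-order comparison [second_derivative_ge0_le] applied on [0, 1] to
   [C t^2 + D t^3 + e g(a + t b) + e' g(a + t b')]. *)
Lemma taylor2_le (R : realType) (g g1 g2 : R -> R) (C D e e' a b b' : R) :
  (forall x : R, is_derive x (1:R) g (g1 x)) ->
  (forall x : R, is_derive x (1:R) g1 (g2 x)) ->
  (forall t, 0 <= t <= 1 -> 0 <= 2 * C + 6 * D * t +
      e * (g2 (a + t * b) * b ^+ 2) + e' * (g2 (a + t * b') * b' ^+ 2)) ->
  (e + e') * g a + (e * b + e' * b') * g1 a <=
  C + D + e * g (a + b) + e' * g (a + b').
Proof.
move=> dg dg1 pos.
have dgb x c (t : R) := comp_affine_is_derive x c dg t.
have dg1b x c (t : R) := comp_affine_is_derive x c dg1 t.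
pose p t := C * t ^+ 2 + D * t ^+ 3 + e * g (a + t * b) + e' * g (a + t * b').
pose p1 t := 2 * C * t + 3 * D * t ^+ 2 + e * (g1 (a + t * b) * b)
  + e' * (g1 (a + t * b') * b').
pose p2 t := 2 * C + 6 * D * t + e * (g2 (a + t * b) * b ^+ 2)
  + e' * (g2 (a + t * b') * b' ^+ 2).
have := @second_derivative_ge0_le R p p1 p2.
suff [H1 H2] : (forall x : R, is_derive x (1:R) p (p1 x)) /\
   (forall x : R, is_derive x (1:R) p1 (p2 x)).
  by move=> /(_ H1 H2 pos); rewrite /p /p1 !mul0r !mul1r !addr0; nra.
split => t.
- apply: is_derive_eq; rewrite /p1 /GRing.scale /= !mulr1.
  by ring.
- apply: is_derive_eq; rewrite /p2 /GRing.scale /= !mulr1.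
  by ring.
Qed.

(* [f1], [f2] and [q] stand for f', f'' and the right derivative f'''; keeping
   them abstract prevents unification from unfolding derivatives into limits. *)
Record convex3 (R : realType) (f f1 f2 q : R -> R) : Prop := Convex3 {
  c3_df : forall x : R, is_derive x (1:R) f (f1 x);
  c3_df1 : forall x : R, is_derive x (1:R) f1 (f2 x);
  c3_nd : {homo f : x y / x <= y};
  c3_nd2 : {homo f2 : x y / x <= y};
  c3_convex : forall t x y, 0 <= t <= 1 ->
    f (t * x + (1 - t) * y) <= t * f x + (1 - t) * f y;
  c3_mid : forall x y, 2 * f x <= f (x + y) + f (x - y);
  c3_mid2 : forall x y, 2 * f2 x <= f2 (x + y) + f2 (x - y);
  c3_slope : forall x y, x <= y ->
    q x * (y - x) <= f2 y - f2 x /\ f2 y - f2 x <= q y * (y - x) }.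

Section third_order_convex.
Context (R : realType) (f f1 f2 q : R -> R) (hf : convex3 f f1 f2 q).

(** Continuation form of [taylor2_le]: applied to any goal [G], it leaves the positivity condition,
    and then [G] with the inequality as an extra premise for [lra]. *)
Let taylor C D e e' a b b' (G : Prop) pos
    (k : (e + e') * f a + (e * b + e' * b') * f1 a <=
         C + D + e * f (a + b) + e' * f (a + b') -> G) : G :=
  k (@taylor2_le R f f1 f2 C D e e' a b b' (c3_df hf) (c3_df1 hf) pos).

(** If [f2 x] were negative, then so would be [f2] on all of (-oo, x] by monotonicity, making [f]
    strictly concave on [x - 2, x]. This contradicts midpoint convexity at [x - 1]. *)
Lemma c3_second_ge0 x : 0 <= f2 x.
Proof.
rewrite leNgt; apply/negP => fx0.
have mid := c3_mid hf (x - 1) 1.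
apply: (@taylor (f2 x) 0 (-1) (-1) (x - 1) 1 (-1)) => [t /andP[t0 t1]|]; last lra.
rewrite mulr1 mulrN1 sqrrN expr1n !mulr1.
have H1 : f2 (x - 1 + t) <= f2 x.
  by apply: (c3_nd2 hf); lra.
have H2 : f2 (x - 1 - t) <= f2 x.
  by apply: (c3_nd2 hf); lra.
lra.
Qed.

Lemma c3_tangent x d : f x + f1 x * d <= f (x + d).
Proof.
apply: (@taylor 0 0 1 0 x d 0) => [t _|]; last lra.
have := mulr_ge0 (c3_second_ge0 (x + t * d)) (sqr_ge0 d).
rewrite expr0n /=; lra.
Qed.

Lemma c3_first_ge0 x : 0 <= f1 x.
Proof.
have := c3_tangent x (-1).
have : f (x - 1) <= f x by apply: (c3_nd hf); lra.
lra.
Qed.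

(** For [x < 0] the monotonicity of [f2] gives [f2 (s + t * x) <= f2 s], so no cubic correction
    arises. This is why only the positive parts of the third moments enter the theorem. *)
Lemma c3_taylor_le (c s x : R) : 0 <= c ->
  (forall x y, x <= y -> f2 y - f2 x <= c * (y - x)) ->
  f (s + x) <= f s + f1 s * x + f2 s * x ^+ 2 / 2
    + c * Num.max 0 x ^+ 3 / 6.
Proof.
move=> c0 f2c; set x' := Num.max 0 x.
apply: (@taylor (f2 s * x ^+ 2 / 2) (c * x' ^+ 3 / 6) (-1) 0 s x 0)
  => [t /andP[t0 t1]|]; last lra.
rewrite expr0n /= mulr0 mulr0 addr0.
suff : 0 <= (f2 s - f2 (s + t * x)) * x ^+ 2 + c * x' ^+ 3 * t by lra.
have [x0|x0] := leP 0 x; rewrite /x'.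
  rewrite (max_idPr x0); have := f2c s (s + t * x).
  have tx : 0 <= t * x by apply: mulr_ge0.
  rewrite lerDl addrAC subrr add0r => /(_ tx) H.
  have := @ler_wpM2r _ (x ^+ 2) (sqr_ge0 x) _ _ H.
  have -> : c * x ^+ 3 * t = c * (t * x) * x ^+ 2 by ring.
  lra.
rewrite (max_idPl (ltW x0)) expr0n /= mulr0 mul0r addr0.
apply: mulr_ge0; last exact: sqr_ge0.
rewrite subr_ge0; apply: (c3_nd2 hf).
by rewrite gerDl mulr_ge0_le0 // ltW.
Qed.

(** Midpoint convexity of [f2], integrated twice. *)
Lemma c3_sym s y : 2 * f s + f2 s * y ^+ 2 <= f (s + y) + f (s - y).
Proof.
apply: (@taylor (- f2 s * y ^+ 2) 0 1 1 s y (- y)) => [t _|]; last lra.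
have := c3_mid2 hf s (t * y) => H.
rewrite mulrN sqrrN.
have := @ler_wpM2r _ (y ^+ 2) (sqr_ge0 y) _ _ H; lra.
Qed.

Lemma c3_third_ge0 x : 0 <= q x.
Proof.
have x1 : x - 1 <= x by lra.
have [_] := c3_slope hf x1.
have := c3_nd2 hf x1.
lra.
Qed.

Lemma c3_third_homo : {homo q : x y / x <= y}.
Proof.
move=> x y; rewrite le_eqVlt => /predU1P[->//|xy].
have [H1 H2] := c3_slope hf (ltW xy).
by have := le_trans H1 H2; rewrite ler_pM2r // subr_gt0.
Qed.

(** Third-order Taylor bound with [f2 (x0 + t * d) >= f2 x0 + q x0 * t * d]; the quadratic term is
    nonnegative and dropped. *)
Lemma c3_cubic_growth x0 d : 0 <= d ->
  f x0 + f1 x0 * d + q x0 * d ^+ 3 / 6 <= f (x0 + d).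
Proof.
move=> d0; apply: (@taylor 0 (- q x0 * d ^+ 3 / 6) 1 0 x0 d 0)
  => [t /andP[t0 t1]|]; last lra.
have td : x0 <= x0 + t * d by rewrite lerDl mulr_ge0.
have [+ _] := c3_slope hf td.
rewrite addrAC subrr add0r => H.
have := @ler_wpM2r _ (d ^+ 2) (sqr_ge0 d) _ _ H.
have := mulr_ge0 (c3_second_ge0 x0) (sqr_ge0 d).
have -> : q x0 * (t * d) * d ^+ 2 = q x0 * d ^+ 3 * t by ring.
lra.
Qed.

End third_order_convex.

Lemma classF3_convex3 (R : realType) (f : R -> R) : classF3 f ->
  exists f1 f2 q : R -> R, [/\ convex3 f f1 f2 q,
    forall x, ((q x)%:E <= f'''_at_infty f)%E &
    forall r : R, (r%:E < f'''_at_infty f)%E -> exists2 x, 0 <= x & r < q x].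
Proof.
move=> hf; pose f1 : R -> R := derive1 f; pose f2 : R -> R := derive1n 2 f.
pose q := right_derivative f2.
have c3 : convex3 f f1 f2 q.
  split.
  - by move=> x; rewrite /f1 derive1E; apply: derivableP; exact: (F3_derivable hf).
  - move=> x; rewrite /f2 derive1nS derive1n1 derive1E; apply: derivableP.
    exact: (F3_derivable' hf).
  - exact: F3_nondecreasing hf.
  - exact: F3_nondecreasing'' hf.
  - exact: convex_function_ineq (F3_convex hf).
  - by move=> x y; exact: convex_function_mid (F3_convex hf).
  - by move=> x y; exact: convex_function_mid (F3_convex'' hf).
  - move=> x y; rewrite le_eqVlt => /predU1P[->|xy]; first by rewrite !subrr !mulr0.
    exact: right_derivative_slope (F3_convex'' hf) xy.
have nd : nondecreasing_fun (fun x => (q x)%:E).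
  by move=> y z yz; rewrite lee_fin; exact: (c3_third_homo c3).
have -> : f'''_at_infty f = ereal_sup (range (fun x => (q x)%:E)).
  by apply: cvg_lim => //; exact: nondecreasing_cvge.
exists f1, f2, q; split => //.
  by move=> x; apply: ereal_sup_ubound; exists x.
move=> r /ereal_sup_gt[_ [x _ <-]]; rewrite lte_fin => rx.
(* [tilt_cubic_growth] compares with the tangent at 0 and needs a nonnegative base point. Moving the
   point to the right only increases [q]. *)
exists (Num.max 0 x); first by rewrite le_max lexx.
by apply: (lt_le_trans rx); apply: (c3_third_homo c3); rewrite le_max lexx orbT.
Qed.

(** * Gaussian integrals *)

(** The Radon-Nikodym derivative of the normal law and the explicit density have the same integral
    over every measurable set, hence agree almost everywhere. *)
Lemma integral_normal_prob (R : realType) (m s : R) (g : R -> \bar R) (A : set R) :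
  measurable A -> measurable_fun [set: R] g -> (forall x, (0 <= g x)%E) ->
  (\int[normal_prob m s]_(x in A) g x =
   \int[lebesgue_measure]_(x in A) (g x * (normal_pdf m s x)%:E))%E.
Proof.
move=> mA mg g0.
have dom := normal_prob_dominates m s.
have mgA : measurable_fun A g by apply: measurable_funTS.
rewrite -(Radon_Nikodym_SigmaFinite.change_of_variables dom g0) //.
set d := Radon_Nikodym_SigmaFinite.f _ _.
have dint : lebesgue_measure.-integrable setT d.
  exact: Radon_Nikodym_SigmaFinite.f_integrable.
have mpdf : measurable_fun A (fun x => (normal_pdf m s x)%:E).
  by apply/measurable_EFinP/measurable_funTS; exact: measurable_normal_pdf.
apply: ae_eq_integral => //.
- apply: emeasurable_funM => //; apply: measurable_funTS.
  exact: measurable_int dint.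
- exact: emeasurable_funM.
- apply: ae_eqe_mul2l; apply: integral_ae_eq => //.
    by apply: integrableS dint.
  by move=> E _ mE; rewrite -Radon_Nikodym_SigmaFinite.f_integral.
Qed.

Lemma measurable_affine (R : realType) (m s : R) :
  measurable_fun [set: R] (fun x : R => m + s * x).
Proof. by apply: measurable_funD => //; apply: measurable_funM. Qed.

(** By uniqueness of Lebesgue measure, half-open intervals suffice. Negative [s] is included because
    the symmetry of the normal law is the case [s = -1]. *)
Lemma lebesgue_measure_affine (R : realType) (m s : R) (A : set R) : s != 0 ->
  measurable A ->
  lebesgue_measure A =
  (`|s|%:E * lebesgue_measure ((fun x : R => m + s * x)%R @^-1` A))%E.
Proof.
move=> s0 mA.
pose phi : measurableTypeR R -> measurableTypeR R := fun x => m + s * x.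
have mphi : measurable_fun setT phi by exact: measurable_affine.
pose s' : {nonneg R} := NngNum (normr_ge0 s).
pose nu := measure_function_pushforward__canonical__measure_function_Measure
  (@lebesgue_measure R) mphi.
apply: (@lebesgue_measure_unique R (mscale s' nu)) => // _ [[a b]] /= ab <-.
rewrite /mscale /= /pushforward /=.
move: s0; rewrite neq_lt => /orP[s0|s0].
  have -> : phi @^-1` `]a, b] = `[(b - m) / s, (a - m) / s[%classic.
    apply/seteqP; split=> x /=; rewrite !in_itv/= /phi;
      rewrite ler_ndivrMr // ltr_ndivlMr // => /andP[h1 h2];
      by apply/andP; split; lra.
  rewrite !lebesgue_measure_itv /= !lte_fin ltr_nM2r ?invr_lt0 // ltrD2r.
  case: ifPn => _; last by rewrite mule0.
  rewrite ltr0_norm // -!EFinD -EFinM; congr EFin; field.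
  by rewrite lt_eqF.
have -> : phi @^-1` `]a, b] = `](a - m) / s, (b - m) / s]%classic.
  apply/seteqP; split=> x /=; rewrite !in_itv/= /phi;
    rewrite ler_pdivlMr // ltr_pdivrMr // => /andP[h1 h2];
    by apply/andP; split; lra.
rewrite !lebesgue_measure_itv /= !lte_fin ltr_pM2r ?invr_gt0 // ltrD2r.
case: ifPn => _; last by rewrite mule0.
rewrite gtr0_norm // -!EFinD -EFinM; congr EFin; field.
by rewrite gt_eqF.
Qed.

Lemma normal_pdf_affine (R : realType) (m s z : R) : s != 0 ->
  `|s| * normal_pdf m s (m + s * z) = normal_pdf 0 1 z.
Proof.
move=> s0; rewrite !normal_pdfE ?oner_eq0 // /normal_peak /normal_fun.
rewrite expr1n mul1r -mulrnAr sqrtrM ?sqr_ge0 // sqrtr_sqr invfM !mulrA.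
rewrite divff ?normr_eq0 // mul1r; congr (_ * expR _).
by field.
Qed.

Lemma ge0_integral_normal_affine (R : realType) (m s : R) (g : R -> \bar R) :
  s != 0 -> measurable_fun [set: R] g -> (forall x, (0 <= g x)%E) ->
  (\int[normal_prob 0 1]_z g (m + s * z)%R =
   \int[lebesgue_measure]_x (g x * (normal_pdf m s x)%:E))%E.
Proof.
move=> s0 mg g0.
pose phi : measurableTypeR R -> measurableTypeR R := fun x => m + s * x.
have mphi : measurable_fun setT phi by exact: measurable_affine.
pose s' : {nonneg R} := NngNum (normr_ge0 s).
pose nu := measure_function_pushforward__canonical__measure_function_Measure
  (@lebesgue_measure R) mphi.
have mpdf : measurable_fun [set: R] (fun x => (normal_pdf m s x)%:E).
  by apply/measurable_EFinP; exact: measurable_normal_pdf.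
have mgp : measurable_fun [set: R] (fun x => g x * (normal_pdf m s x)%:E)%E.
  exact: emeasurable_funM.
have mgphi : measurable_fun [set: R] (fun z => g (m + s * z)).
  by apply: (measurableT_comp mg); exact: measurable_affine.
rewrite (integral_normal_prob 0 1 measurableT mgphi); last by move=> z; exact: g0.
rewrite [RHS](@eq_measure_integral _ _ _ _ (mscale s' nu) lebesgue_measure);
  last first.
  by move=> A mA _; exact: lebesgue_measure_affine.
rewrite ge0_integral_mscale //=; last first.
  by move=> x _; rewrite mule_ge0 // lee_fin normal_pdf_ge0.
rewrite (ge0_integral_pushforward mphi) //; last first.
  by move=> x _; rewrite mule_ge0 // lee_fin normal_pdf_ge0.
rewrite preimage_setT -ge0_integralZl //.
- apply: eq_integral => x _ /=.
  by rewrite muleCA -EFinM normal_pdf_affine.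
- exact: (measurableT_comp mgp).
- by move=> x _; rewrite mule_ge0 // lee_fin normal_pdf_ge0.
Qed.

Section standard_normal_integrals.
Context {R : realType}.
Local Notation gauss := (@normal_prob R 0 1).

Lemma ge0_integral_normalN (g : R -> \bar R) :
  measurable_fun [set: R] g -> (forall x, (0 <= g x)%E) ->
  (\int[gauss]_z g (- z)%R = \int[gauss]_z g z)%E.
Proof.
move=> mg g0; have N0 : (-1 : R) != 0 by rewrite oppr_eq0 oner_eq0.
transitivity (\int[gauss]_z g (0 + -1 * z)%R)%E.
  by apply: eq_integral => z _; rewrite add0r mulN1r.
rewrite (ge0_integral_normal_affine 0 N0 mg g0).
rewrite (integral_normal_prob 0 1 measurableT mg g0).
apply: eq_integral => x _; congr (_ * (_)%:E)%E.
by rewrite !normal_pdfE ?oner_eq0 // /normal_peak /normal_fun sqrrN.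
Qed.

Lemma normal_peakE (s : R) : normal_peak s = (`|s| * Num.sqrt (pi *+ 2))^-1.
Proof. by rewrite /normal_peak -mulrnAr sqrtrM ?sqr_ge0 // sqrtr_sqr. Qed.

(** The integrand times the standard density is [s] times the density of scale [s], whose total mass
    is 1. All moment facts below are drawn from this family of exponential integrals. *)
Lemma integral_normal_expR (s : R) : 0 < s ->
  (\int[gauss]_z (expR ((1 - s ^- 2) * (z ^+ 2 / 2)))%:E = s%:E)%E.
Proof.
move=> s0; have sN0 : s != 0 by rewrite gt_eqF.
have me : measurable_fun [set: R]
    (fun z : R => (expR ((1 - s ^- 2) * (z ^+ 2 / 2)))%:E).
  apply/measurable_EFinP; apply: measurableT_comp => //.
  by do 2?[apply: measurable_funM => //]; exact: exprn_measurable.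
rewrite integral_normal_prob //.
transitivity (\int[lebesgue_measure]_x (s%:E * (normal_pdf 0 s x)%:E))%E.
  apply: eq_integral => x _; rewrite -!EFinM; congr EFin.
  rewrite !normal_pdfE ?oner_eq0 // !normal_peakE !gtr0_norm // mul1r.
  rewrite /normal_fun expr1n.
  have P0 : Num.sqrt (pi *+ 2) != 0 :> R.
    by rewrite gt_eqF // sqrtr_gt0 pmulrn_lgt0 // pi_gt0.
  have -> : expR (- (x - 0) ^+ 2 / (s ^+ 2 *+ 2)) =
      expR ((1 - s ^- 2) * (x ^+ 2 / 2)) * expR (- (x - 0) ^+ 2 / (1 *+ 2)).
    by rewrite -expRD; congr expR; rewrite !subr0; field.
  by field; rewrite sN0 P0.
rewrite ge0_integralZl ?integral_normal_pdf ?mule1 ?lee_fin ?ltW //.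
  by apply/measurable_EFinP; exact: measurable_normal_pdf.
by move=> x _; rewrite lee_fin normal_pdf_ge0.
Qed.

(* Completing the square in y. *)
Lemma normal_pdf_conv (a b x y : R) : 0 < b ->
  let c := Num.sqrt (a ^+ 2 + b ^+ 2) in
  normal_pdf (a * y) b x * normal_pdf 0 1 y =
  normal_pdf 0 c x * normal_pdf (a * x / c ^+ 2) (b / c) y.
Proof.
move=> b0 c; have bN0 : b != 0 by rewrite gt_eqF.
have ab0 : 0 < a ^+ 2 + b ^+ 2 by have := sqr_ge0 a; have := mulr_gt0 b0 b0; nra.
have c0 : 0 < c by rewrite sqrtr_gt0.
have cN0 : c != 0 by rewrite gt_eqF.
have c2 : c ^+ 2 = a ^+ 2 + b ^+ 2 by rewrite sqr_sqrtr // ltW.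
rewrite !normal_pdfE ?oner_eq0 ?mulf_neq0 ?invr_neq0 //.
rewrite !normal_peakE !gtr0_norm ?divr_gt0 // mul1r /normal_fun expr1n.
have P0 : Num.sqrt (pi *+ 2) != 0 :> R.
  by rewrite gt_eqF // sqrtr_gt0 pmulrn_lgt0 // pi_gt0.
set e1 := expR _; set e2 := expR _; set e3 := expR _; set e4 := expR _.
suff e1234 : e1 * e2 = e3 * e4.
  transitivity ((b * Num.sqrt (pi *+ 2) * Num.sqrt (pi *+ 2))^-1 * (e1 * e2)).
    by field; rewrite bN0 P0.
  by rewrite e1234; field; rewrite bN0 P0 cN0.
rewrite /e1 /e2 /e3 /e4 -!expRD; congr expR; rewrite expr_div_n c2.
by field; rewrite bN0 gt_eqF.
Qed.

(** Once the square is completed and the integrals are exchanged, the inner integral over [y] is the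
    total mass of a normal density, so only the law of scale [c] remains. *)
Lemma ge0_integral_normal_conv (a b : R) (g : R -> \bar R) :
  0 <= a -> 0 <= b -> measurable_fun [set: R] g -> (forall x, (0 <= g x)%E) ->
  (\int[gauss]_y \int[gauss]_z g (a * y + b * z)%R =
   \int[gauss]_z g (Num.sqrt (a ^+ 2 + b ^+ 2) * z)%R)%E.
Proof.
move=> a0 b0' mg g0.
(* At scale 0 there is no density, so this degenerate case is settled by hand. *)
have [->|bN0] := eqVneq b 0.
  rewrite expr0n addr0 sqrtr_sqr ger0_norm //; apply: eq_integral => y _.
  under eq_integral do rewrite mul0r addr0.
  by rewrite integral_cst // [X in (_ * X)%E]probability_setT mule1.
have b0 : 0 < b by rewrite lt_neqAle eq_sym bN0.
set c := Num.sqrt _.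
have ab0 : 0 < a ^+ 2 + b ^+ 2 by have := sqr_ge0 a; have := mulr_gt0 b0 b0; nra.
have cN0 : c != 0 by rewrite gt_eqF // sqrtr_gt0.
have mpdf (u v : R) : measurable_fun [set: R] (fun x => (normal_pdf u v x)%:E).
  by apply/measurable_EFinP; exact: measurable_normal_pdf.
transitivity (\int[gauss]_y \int[lebesgue_measure]_x
    (g x * (normal_pdf (a * y) b x)%:E))%E.
  by apply: eq_integral => y _; rewrite -ge0_integral_normal_affine.
pose F (p : measurableTypeR R * measurableTypeR R) :=
  (g p.2 * (normal_pdf (a * p.1) b p.2)%:E * (normal_pdf 0 1 p.1)%:E)%E.
have F0 p : (0 <= F p)%E by rewrite !mule_ge0 // lee_fin normal_pdf_ge0.
have mab : measurable_fun [set: R * R] (fun p : R * R => normal_pdf (a * p.1) b p.2).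
  rewrite (_ : (fun p => _) = normal_pdf 0 b \o (fun p : R * R => p.2 - a * p.1)).
    apply: measurableT_comp; first exact: measurable_normal_pdf.
    by apply: measurable_funB => //; apply: measurable_funM.
  by apply/funext => p /=; rewrite !normal_pdfE // /normal_fun subr0.
have mgab : measurable_fun [set: R * R]
    (fun p : R * R => (g p.2 * (normal_pdf (a * p.1) b p.2)%:E)%E).
  apply: emeasurable_funM; first exact: (measurableT_comp mg).
  exact/measurable_EFinP.
have mF : measurable_fun setT F.
  apply: emeasurable_funM => //.
  exact: (measurableT_comp (mpdf 0 1)).
rewrite integral_normal_prob //; last first.
- move=> y; apply: integral_ge0 => x _.
  by rewrite mule_ge0 // lee_fin normal_pdf_ge0.
- apply: (@measurable_fun_fubini_tonelli_F _ _ _ _ _ lebesgue_measure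
    (fun p : measurableTypeR R * measurableTypeR R =>
       (g p.2 * (normal_pdf (a * p.1) b p.2)%:E)%E)) => //.
  by move=> p; rewrite mule_ge0 // lee_fin normal_pdf_ge0.
transitivity (\int[lebesgue_measure]_y \int[lebesgue_measure]_x F (y, x))%E.
  apply: eq_integral => y _; rewrite -ge0_integralZr ?lee_fin ?normal_pdf_ge0 //.
  - by apply: emeasurable_funM => //; exact: mpdf.
  - by move=> x _; rewrite mule_ge0 // lee_fin normal_pdf_ge0.
have -> := fubini_tonelli F mF F0.
under [RHS]eq_integral do rewrite -[X in g X]add0r.
rewrite ge0_integral_normal_affine //; apply: eq_integral => x _.
rewrite /fubini_G /F /=.
transitivity (\int[lebesgue_measure]_y (g x * (normal_pdf 0 c x)%:E *
   (normal_pdf (a * x / c ^+ 2) (b / c) y)%:E))%E.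
  by apply: eq_integral => y _; rewrite -!muleA -!EFinM normal_pdf_conv.
rewrite ge0_integralZl ?integral_normal_pdf ?mule1 //.
- exact: mpdf.
- by move=> y _; rewrite lee_fin normal_pdf_ge0.
- by rewrite mule_ge0 // lee_fin normal_pdf_ge0.
Qed.

Let exp_ineq (x : R) : 0 <= x -> x ^+ 2 <= 4 * expR x.
Proof.
move=> x0; have := expR_ge1Dx (x / 2); have -> : expR x = expR (x / 2) ^+ 2.
  by rewrite expr2 -expRD; congr expR; field.
nra.
Qed.

Let mpow n : measurable_fun [set: R] (fun z : R => (z ^+ n)%:E).
Proof. by apply/measurable_EFinP; exact: exprn_measurable. Qed.

(** For [s = sqrt 2] the exponent is z^2 / 4, and [exp_ineq] at that point gives z^4 / 16 <= 4 exp
    (z^2 / 4); hence the constant 64. *)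
Lemma normal_fourth_moment_lty : (\int[gauss]_z (z ^+ 4)%:E < +oo)%E.
Proof.
have s0 : 0 < Num.sqrt 2 :> R by rewrite sqrtr_gt0.
have H := integral_normal_expR s0.
apply: (@le_lt_trans _ _ (\int[gauss]_z (64%:E *
    (expR ((1 - Num.sqrt 2 ^- 2) * (z ^+ 2 / 2)))%:E))%E).
  apply: ge0_le_integral => //.
  - by move=> z _; rewrite lee_fin exprn_even_ge0.
  - exact: mpow.
  - apply/measurable_EFinP; apply: measurable_funM => //.
    apply: measurableT_comp => //.
    by do 2?[apply: measurable_funM => //]; exact: exprn_measurable.
  - move=> z _; rewrite -EFinM lee_fin sqr_sqrtr //.
    have z2 : 0 <= z ^+ 2 / 4 by rewrite divr_ge0 ?sqr_ge0.
    have := exp_ineq z2.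
    have -> : (1 - 2^-1) * (z ^+ 2 / 2) = z ^+ 2 / 4 by field.
    have -> : (z ^+ 2 / 4) ^+ 2 = z ^+ 4 / 16 by field.
    lra.
rewrite ge0_integralZl //.
  by rewrite H -EFinM ltry.
apply/measurable_EFinP; apply: measurableT_comp => //.
by do 2?[apply: measurable_funM => //]; exact: exprn_measurable.
Qed.

Let msqr := mpow 2.

Let mexp s : measurable_fun [set: R]
  (fun z : R => (expR ((1 - s ^- 2) * (z ^+ 2 / 2)))%:E).
Proof.
apply/measurable_EFinP; apply: measurableT_comp => //.
by do 2?[apply: measurable_funM => //]; exact: exprn_measurable.
Qed.

(* Integrating [1 + u <= expR u] at [u = (1 - s^-2) z^2 / 2] on both sides of
   s = 1 squeezes the second moment between values of [2 s^2 / (1 + s)]. *)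
Lemma normal_second_moment : (\int[gauss]_z (z ^+ 2)%:E = 1)%E.
Proof.
set M := (\int[gauss]_z _)%E.
have M0 : (0 <= M)%E by apply: integral_ge0 => z _; rewrite lee_fin sqr_ge0.
have one : (\int[gauss]_z 1 = 1)%E.
  by rewrite integral_cst // [X in (_ * X)%E]probability_setT mule1.
have up s : 1 <= s -> (1 + ((1 - s ^- 2) / 2)%:E * M <= s%:E)%E.
  move=> s1; have k0 : 0 <= (1 - s ^- 2) / 2.
    rewrite divr_ge0 // subr_ge0 invf_le1 ?exprn_gt0 //; last by lra.
    by rewrite expr_ge1 //; lra.
  rewrite -(@integral_normal_expR s); last by lra.
  rewrite -one -ge0_integralZl //=; last by move=> z _; rewrite lee_fin sqr_ge0.
  rewrite -ge0_integralD //=; last 2 first.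
  - by move=> z _; rewrite mule_ge0 // lee_fin ?sqr_ge0.
  - by apply: measurable_funeM.
  apply: ge0_le_integral => //=.
  - by move=> z _; rewrite adde_ge0 // mule_ge0 // lee_fin ?sqr_ge0.
  - by apply: emeasurable_funD => //; apply: measurable_funeM.
  - exact: mexp.
  - move=> z _; rewrite -EFinM -EFinD lee_fin.
    by have := expR_ge1Dx ((1 - s ^- 2) * (z ^+ 2 / 2)); rewrite mulrA mulrAC.
have lo s : 0 < s -> s <= 1 -> (1 <= s%:E + ((s ^- 2 - 1) / 2)%:E * M)%E.
  move=> s0 s1; have k0 : 0 <= (s ^- 2 - 1) / 2.
    rewrite divr_ge0 // subr_ge0 invf_ge1 ?exprn_gt0 //.
    by rewrite expr_le1 // ltW.
  rewrite -(@integral_normal_expR s) //.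
  rewrite -one -ge0_integralZl //=; last by move=> z _; rewrite lee_fin sqr_ge0.
  rewrite -ge0_integralD //=; last 3 first.
  - exact: mexp.
  - by move=> z _; rewrite mule_ge0 // lee_fin ?sqr_ge0.
  - by apply: measurable_funeM.
  apply: ge0_le_integral => //=.
  - by apply: emeasurable_funD => //; [exact: mexp|apply: measurable_funeM].
  - move=> z _; rewrite -EFinM -EFinD lee_fin.
    have := expR_ge1Dx ((1 - s ^- 2) * (z ^+ 2 / 2)).
    by lra.
(* The upper inequality at [s = 2] already excludes [M = +oo]. *)
have Mfin : M \is a fin_num.
  rewrite ge0_fin_numE //; have := up 2 ltac:(lra).
  apply: contraLR; rewrite -leNgt leye_eq => /eqP ->.
  by rewrite mulry gtr0_sg ?mul1e ?addey ?leye_eq //; lra.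
clearbody M.
rewrite -(fineK Mfin) in up lo *; congr EFin.
set m := fine M in up lo *.
(* If [m] differs from 1, the choice of [s] halfway between 1 and [m] violates one of the two
   inequalities, by (e^2 / 2) / s^2 with e = |m - 1| / 2. *)
apply/eqP; rewrite eq_le; apply/andP; split; rewrite leNgt; apply/negP => m1.
- have e0 : 0 < (m - 1) / 2 by lra.
  have := up (1 + (m - 1) / 2) ltac:(lra).
  rewrite -EFinM -EFinD lee_fin.
  set e := (m - 1) / 2 in e0 *; have -> : m = 1 + 2 * e by rewrite /e; field.
  have e1 : 1 + e != 0 by rewrite gt_eqF //; lra.
  rewrite leNgt => /negP; apply.
  rewrite -subr_gt0.
  have -> : 1 + (1 - (1 + e) ^- 2) / 2 * (1 + 2 * e) - (1 + e) =
    (e ^+ 2 / 2) / (1 + e) ^+ 2 by field.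
  by rewrite !divr_gt0 ?exprn_gt0 //; lra.
- have m0 : 0 <= m by rewrite /m fine_ge0.
  have e0 : 0 < (1 - m) / 2 by lra.
  have := lo (1 - (1 - m) / 2) ltac:(lra) ltac:(lra).
  rewrite -EFinM -EFinD lee_fin.
  set e := (1 - m) / 2 in e0 *; have me : m = 1 - 2 * e by rewrite /e; field.
  rewrite me; have e1 : 1 - e != 0 by rewrite gt_eqF //; lra.
  rewrite leNgt => /negP; apply.
  rewrite -subr_gt0.
  have -> : 1 - (1 - e + ((1 - e) ^- 2 - 1) / 2 * (1 - 2 * e)) =
    (e ^+ 2 / 2) / (1 - e) ^+ 2 by field.
  by rewrite !divr_gt0 ?exprn_gt0 //; lra.
Qed.

Lemma normal_third_moment_lty :
  (\int[gauss]_z (Num.max 0 z ^+ 3)%:E < +oo)%E.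
Proof.
apply: (@le_lt_trans _ _ (\int[gauss]_z (1 + (z ^+ 4)%:E))%E); last first.
  have z4 (z : R) : (0 <= (z ^+ 4)%:E)%E by rewrite lee_fin exprn_even_ge0.
  rewrite ge0_integralD //; last exact: mpow.
  rewrite lte_add_pinfty // ?normal_fourth_moment_lty //.
  by rewrite integral_cst // [X in (_ * X)%E]probability_setT mule1 ltry.
apply: ge0_le_integral => //.
- by move=> z _; rewrite lee_fin exprn_ge0 // le_max lexx.
- apply/measurable_EFinP; apply: measurable_funX.
  exact: measurable_maxr.
- by apply: emeasurable_funD => //; exact: mpow.
- move=> z _; rewrite lee_fin; have [z0|z0] := leP 0 z.
    by have := sqr_ge0 (z ^+ 2 - z); have := sqr_ge0 (z - 1); nra.
  by rewrite expr0n /= addr_ge0 // exprn_even_ge0.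
Qed.

Lemma normal_integrable_id : gauss.-integrable setT (fun z : R => z%:E).
Proof.
apply/integrableP; split; first exact/measurable_EFinP.
apply: (@le_lt_trans _ _ (\int[gauss]_z (1 + (z ^+ 2)%:E))%E); last first.
  rewrite ge0_integralD //; last by move=> z _; rewrite lee_fin sqr_ge0.
  rewrite normal_second_moment lte_add_pinfty // ?ltry //.
  by rewrite integral_cst // [X in (_ * X)%E]probability_setT mule1 ltry.
apply: ge0_le_integral => //.
- by apply: measurableT_comp => //; exact/measurable_EFinP.
- by apply: emeasurable_funD.
- move=> z _; rewrite /= lee_fin ler_norml; apply/andP; split; nra.
Qed.

Lemma normal_first_moment : (\int[gauss]_z z%:E = 0)%E.
Proof.
have iid := normal_integrable_id.
have mpos : measurable_fun [set: R] (fun z : R => z%:E)^\+%E.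
  by apply: measurable_funepos; exact/measurable_EFinP.
rewrite integralE.
have -> : (\int[gauss]_z (fun z : R => z%:E)^\- z =
    \int[gauss]_z (fun z : R => z%:E)^\+ z)%E.
  rewrite -ge0_integral_normalN //; last first.
    by apply: measurable_funeneg; exact/measurable_EFinP.
  by apply: eq_integral => z _; rewrite funenegE funeposE /= opprK.
rewrite subee // ge0_fin_numE ?integral_funepos_lt_pinfty //.
by apply: integral_ge0 => z _; rewrite funepos_ge0.
Qed.

End standard_normal_integrals.

(** * Sums of independent variables *)

Lemma finite_measure_eq_rectangles d1 d2 (T1 : measurableType d1)
    (T2 : measurableType d2) (R : realType)
    (m1 m2 : {measure set (T1 * T2) -> \bar R}) :
  (m1 setT < +oo)%E ->
  (forall A B, measurable A -> measurable B -> m1 (A `*` B) = m2 (A `*` B)) ->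
  forall C, measurable C -> m1 C = m2 C.
Proof.
move=> m1fin m12 C mC.
pose G : set (set (T1 * T2)) :=
  [set C | exists A, measurable A /\ exists B, measurable B /\ C = A `*` B].
have GI : setI_closed G.
  move=> /= _ _ [X1 [mX1 [X2 [mX2 ->]]]] [Y1 [mY1 [Y2 [mY2 ->]]]].
  rewrite -setXI; exists (X1 `&` Y1); split; first exact: measurableI.
  by exists (X2 `&` Y2); split => //; exact: measurableI.
apply: (@measure_unique _ _ _ G (fun=> setT)) => //.
- rewrite measurable_prod_measurableType //; congr (<<s _ >>).
  rewrite predeqE; split => [[A mA [B mB <-]]|[A [mA [B [mB ->]]]]].
    by exists A; split => //; exists B.
  by exists A => //; exists B.
- by move=> _; exists setT; split => //; exists setT; rewrite setXTT.
- by rewrite bigcup_const //; exists 0%N.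
- by move=> _ [A [mA [B [mB ->]]]]; exact: m12.
Qed.

Lemma sum_ltnS (R : realType) (n k : nat) (kn : (k < n)%N) (F : 'I_n -> R) :
  \sum_(i < n | (i < k.+1)%N) F i = \sum_(i < n | (i < k)%N) F i + F (Ordinal kn).
Proof.
rewrite (bigD1 (Ordinal kn)) //= addrC; congr (_ + _).
apply: eq_bigl => i; rewrite ltnS ltn_neqAle andbC.
by rewrite -(inj_eq val_inj).
Qed.

Section independence.
Context (R : realType) (d : measure_display) (T : measurableType d)
  (P : probability T R).

(** The factorization on rectangles identifies the joint law of [U] and [V] with the product of
    their laws; Tonelli then splits the integral. *)
Lemma integral_add_indep (U V : {RV P >-> R}) (g : R -> \bar R) :
  (forall A B, measurable A -> measurable B ->
     P (U @^-1` A `&` V @^-1` B) = P (U @^-1` A) * P (V @^-1` B))%E ->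
  measurable_fun [set: R] g -> (forall x, (0 <= g x)%E) ->
  (\int[P]_w g (U w + V w)%R = \int[P]_w \int[P]_w' g (U w + V w')%R)%E.
Proof.
move=> indep mg g0.
pose phi w := (U w, V w).
have mphi : measurable_fun setT phi by apply: measurable_fun_pair.
pose nu := measure_function_pushforward__canonical__measure_function_Measure
  P mphi.
have nuE : forall C, measurable C ->
    (distribution P U \x distribution P V)%E C = nu C.
  by apply: product_measure_unique => A B mA mB; exact: indep.
pose G (p : R * R) := g (p.1 + p.2).
have mG : measurable_fun setT G.
  by apply: (measurableT_comp mg); exact: measurable_funD.
have G0 p : (0 <= G p)%E by exact: g0.
transitivity (\int[nu]_p G p)%E.
  by rewrite (ge0_integral_pushforward mphi) // preimage_setT.
rewrite -(@eq_measure_integral _ _ _ setT nu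
  (distribution P U \x distribution P V)%E);
  last by move=> C mC _; exact: nuE.
rewrite fubini_tonelli1 // ge0_integral_distribution //.
- apply: eq_integral => w _; rewrite /fubini_F /= ge0_integral_distribution //.
  exact: (measurableT_comp mG).
- exact: measurable_fun_fubini_tonelli_F.
- by move=> x; apply: integral_ge0.
Qed.

Variables (n : nat) (X : 'I_n -> {RV P >-> R}).

(** A filtered sum over the fixed type ['I_n], so that inductions on [k] need no change of index
    type. *)
Definition partial_sum (k : nat) (w : T) : R := \sum_(i < n | (i < k)%N) X i w.

Lemma measurable_partial_sum k : measurable_fun [set: T] (partial_sum k).
Proof.
rewrite (_ : partial_sum k = fun w => \sum_(i < n) (if (i < k)%N then X i w else 0)).
  by apply: measurable_sum => i; case: (i < k)%N.
by apply/funext => w; rewrite /partial_sum big_mkcond.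
Qed.

Definition partial_sum_RV k : {RV P >-> R} :=
  mfun_Sub (mem_set (measurable_partial_sum k)).

Lemma partial_sumS k (kn : (k < n)%N) w :
  partial_sum k.+1 w = partial_sum k w + X (Ordinal kn) w.
Proof. exact: sum_ltnS. Qed.

Lemma partial_sum_all w : partial_sum n w = \sum_(i < n) X i w.
Proof. by apply: eq_bigl => i; rewrite ltn_ord. Qed.

Hypothesis indX : mutually_independent X.

Let cylinder (J : {set 'I_n}) (A : 'I_n -> set R) : set T :=
  \bigcap_(i in [set` J]) (X i @^-1` A i).

Let measurable_cylinder J A : (forall i, measurable (A i)) ->
  measurable (cylinder J A).
Proof.
move=> mA; apply: fin_bigcap_measurable => // i _.
by rewrite -[X in measurable X]setTI; exact: measurable_funP.
Qed.

Let cylinderU (k : 'I_n) (J : {set 'I_n}) (A : 'I_n -> set R)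
    (B : set R) : k \notin J ->
  (X k @^-1` B) `&` cylinder J A =
  cylinder (k |: J) (fun i => if i == k then B else A i).
Proof.
move=> kJ; apply/seteqP; split => w.
- move=> [Bw Aw] i /=; rewrite !inE => /orP[/eqP->|iJ]; first by rewrite eqxx.
  by case: eqP => [->|_] //; exact: Aw.
- move=> Cw; split.
    by have := Cw k; rewrite /= !inE eqxx; apply.
  move=> i /= iJ; have := Cw i; rewrite /= !inE iJ orbT => /(_ isT).
  by case: eqP => [ik|//]; move: kJ; rewrite -ik iJ.
Qed.

(* For fixed J and A, both sides are finite measures of the event that
   (S_k, X_k) lies in C; they agree on rectangles, hence on {x + y in B}. *)
Lemma partial_sum_cylinder_indep k : (k <= n)%N ->
  forall (J : {set 'I_n}) A B, (forall i, measurable (A i)) -> measurable B ->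
  (forall i, i \in J -> (k <= i)%N) ->
  (P (partial_sum k @^-1` B `&` cylinder J A) =
   P (partial_sum k @^-1` B) * P (cylinder J A))%E.
Proof.
elim: k => [_|k IH kn] J A B mA mB kJ.
  have S0 w : partial_sum 0 w = 0 by rewrite /partial_sum big_pred0.
  have [B0|B0] := pselect (B 0).
    have -> : partial_sum 0 @^-1` B = setT.
      by apply/seteqP; split => // w _ /=; rewrite S0.
    by rewrite setTI [X in (X * _)%E]probability_setT mul1e.
  have -> : partial_sum 0 @^-1` B = set0.
    by apply/seteqP; split => // w /=; rewrite S0.
  by rewrite set0I measure0 mul0e.
have {}IH := IH (ltnW kn).
pose k' := Ordinal kn.
set E := cylinder J A.
have mE : measurable E by exact: measurable_cylinder.
have k'J : k' \notin J by apply/negP => /kJ /=; rewrite ltnn.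
have mS := measurable_partial_sum k.
pose phi w := (partial_sum k w, X k' w).
have mphi : measurable_fun setT phi by apply: measurable_fun_pair.
pose m' := measure_function_pushforward__canonical__measure_function_Measure
  (mrestr P mE) mphi.
have PE0 : 0 <= fine (P E) by rewrite fine_ge0.
have PEfin : P E \is a fin_num by exact: fin_num_measure.
pose m'' := mscale (NngNum PE0)
  (measure_function_pushforward__canonical__measure_function_Measure P mphi).
have m'E C : measurable C -> m' C = m'' C.
  apply: finite_measure_eq_rectangles => [|A1 A2 mA1 mA2].
    rewrite /m' /= /pushforward /mrestr preimage_setT setTI.
    by rewrite (le_lt_trans (probability_le1 P mE)) ?ltry.
  rewrite /m' /m'' /= /mscale /= /pushforward /mrestr fineK //.
  have -> : phi @^-1` (A1 `*` A2) =
    partial_sum k @^-1` A1 `&` X k' @^-1` A2 by [].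
  rewrite -setIA cylinderU // IH //; first last.
  - by move=> i; rewrite !inE => /orP[/eqP->//|/kJ /ltnW].
  - by move=> i; case: eqP.
  have -> : X k' @^-1` A2 = cylinder [set k'] (fun=> A2).
    apply/seteqP; split => w; first by move=> A2w i /=; rewrite inE => /eqP->.
    by apply; rewrite /= inE.
  rewrite IH //; last by move=> i; rewrite inE => /eqP->.
  rewrite muleCA; congr (_ * _)%E.
  rewrite /cylinder !indX //; last by move=> i; case: eqP.
  rewrite big_setU1 //= eqxx muleC big_set1; congr (_ * _)%E.
  by apply: eq_bigr => i iJ; case: eqP => // ik; move: k'J; rewrite -ik iJ.
have mC : measurable [set p : R * R | B (p.1 + p.2)].
  rewrite -[X in measurable X]setTI.
  have madd : measurable_fun [set: R * R] (fun p : R * R => p.1 + p.2).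
    exact: measurable_funD.
  exact: madd.
have := m'E _ mC; rewrite /m' /m'' /= /mscale /= /pushforward /mrestr fineK //.
have -> : phi @^-1` [set p : R * R | B (p.1 + p.2)] = partial_sum k.+1 @^-1` B.
  by apply/seteqP; split => w /=; rewrite (partial_sumS kn).
by rewrite muleC.
Qed.

Lemma integral_partial_sumS k (kn : (k < n)%N) (g : R -> \bar R) :
  measurable_fun [set: R] g -> (forall x, (0 <= g x)%E) ->
  (\int[P]_w g (partial_sum k.+1 w) =
   \int[P]_w \int[P]_w' g (partial_sum k w + X (Ordinal kn) w')%R)%E.
Proof.
move=> mg g0; under eq_integral do rewrite (partial_sumS kn).
apply: (@integral_add_indep (partial_sum_RV k)) => // A B mA mB.
have H := @partial_sum_cylinder_indep k (ltnW kn) [set Ordinal kn] (fun=> B) A.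
have -> : X (Ordinal kn) @^-1` B = cylinder [set Ordinal kn] (fun=> B).
  apply/seteqP; split => w; first by move=> A2w i /=; rewrite inE => /eqP->.
  by apply; rewrite /= inE.
by apply: H => // i; rewrite inE => /eqP->.
Qed.

End independence.

(** * Realizing prescribed laws on product spaces *)

Section extend_independent.
Context (R : realType) (d : measure_display) (T : measurableType d)
  (P : probability T R) (n : nat) (X : 'I_n -> {RV P >-> R})
  (Q : probability R R).

Definition extend_fun (i : 'I_n.+1) (w : T * R) : R :=
  if unlift ord_max i is Some j then X j w.1 else w.2.

Lemma measurable_extend_fun i : measurable_fun [set: T * R] (extend_fun i).
Proof.
rewrite /extend_fun; case: (unlift _ i) => [j|]; last exact: measurable_snd.
by apply: (measurableT_comp (measurable_funP (X j))); exact: measurable_fst.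
Qed.

Definition extend_RV i : {RV (P \x Q)%E >-> R} :=
  mfun_Sub (mem_set (measurable_extend_fun i)).

Lemma extend_RV_lift j A : measurable A ->
  (P \x Q)%E (extend_RV (lift ord_max j) @^-1` A) = P (X j @^-1` A).
Proof.
move=> mA; have mXA : measurable (X j @^-1` A).
  by rewrite -[X in measurable X]setTI; exact: measurable_funP.
rewrite (_ : extend_RV _ @^-1` A = (X j @^-1` A) `*` setT).
  by rewrite product_measure1E //= [X in (_ * X)%E]probability_setT mule1.
by apply/seteqP; split => w /=; rewrite /extend_fun liftK => // -[].
Qed.

Lemma extend_RV_max A : measurable A ->
  (P \x Q)%E (extend_RV ord_max @^-1` A) = Q A.
Proof.
move=> mA; rewrite (_ : extend_RV _ @^-1` A = setT `*` A).
  by rewrite product_measure1E //= [X in (X * _)%E]probability_setT mul1e.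
by apply/seteqP; split => w /=; rewrite /extend_fun unlift_none => // -[].
Qed.

(** A cylinder of the extended family is a rectangle: a cylinder of [X] times the constraint on the
    new coordinate, which is [setT] when [ord_max] is not in [J]. *)
Lemma extend_RV_independent :
  mutually_independent X -> mutually_independent extend_RV.
Proof.
move=> indX J A mA.
pose J' : {set 'I_n} := finset (fun j => lift ord_max j \in J).
pose B := if ord_max \in J then A ord_max else setT.
have mB : measurable B by rewrite /B; case: ifP.
have -> : \bigcap_(i in [set` J]) (extend_RV i @^-1` A i) =
    (\bigcap_(j in [set` J']) (X j @^-1` A (lift ord_max j))) `*` B.
  apply/seteqP; split => w.
  - move=> Hw; split=> [j /= jJ|].
      rewrite inE in jJ.
      by have := Hw _ jJ; rewrite /= /extend_fun liftK.
    rewrite /B; case: ifPn => // mJ.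
    by have := Hw _ mJ; rewrite /= /extend_fun unlift_none.
  - move=> [Hw1 Hw2] i /= iJ; rewrite /extend_fun.
    case: unliftP => [j ij|im].
      by rewrite ij in iJ *; apply: Hw1; rewrite /= inE.
    by move: Hw2; rewrite /B im -im iJ.
have mcyl : measurable (\bigcap_(j in [set` J']) (X j @^-1` A (lift ord_max j))).
  apply: fin_bigcap_measurable => // j _.
  by rewrite -[X in measurable X]setTI; exact: measurable_funP.
transitivity (P (\bigcap_(j in [set` J']) (X j @^-1` A (lift ord_max j))) * Q B)%E.
  exact: product_measure1E.
rewrite (indX J') //.
rewrite [RHS]big_mkcond /= big_ord_recr /= [in LHS]big_mkcond /=.
congr (_ * _)%E.
  apply: eq_bigr => j _; rewrite inE.
  have -> : widen_ord (leqnSn n) j = lift ord_max j.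
    by apply: val_inj; rewrite /= /bump leqNgt ltn_ord.
  by case: ifP => // _; rewrite extend_RV_lift.
rewrite /B; case: ifP => _; first by rewrite extend_RV_max.
by rewrite [LHS]probability_setT.
Qed.

End extend_independent.

(** Iterated binary products supply the variables. Indexing the laws by [nat] lets the same [Q]
    serve at every stage of the induction. *)
Lemma exists_independent (R : realType) (n : nat) (Q : nat -> probability R R) :
  exists (d : measure_display) (T : measurableType d) (P : probability T R)
    (X : 'I_n -> {RV P >-> R}), mutually_independent X /\
    forall i A, measurable A -> P (X i @^-1` A) = Q i A.
Proof.
elim: n => [|n [d [T [P [X [indX lawX]]]]]].
  (* For an empty family any probability space will do; [Q 0] provides one. *)
  exists _, R, (Q 0%N), (fun=> mfun_Sub (mem_set (@measurable_id _ R setT))).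
  split => [J A mA|[//]].
  have -> : J = finset.set0 by apply/setP => -[].
  rewrite big_set0 (_ : bigcap _ _ = setT) ?probability_setT //.
  by apply/seteqP; split => // w _ [].
exists _, _, (P \x Q n)%E, (extend_RV X (Q n)).
split; first exact: extend_RV_independent.
move=> i A mA; case: (unliftP ord_max i) => [j ->|->].
  by apply: (etrans (extend_RV_lift X (Q n) j mA)); rewrite lawX // lift_max.
exact: extend_RV_max.
Qed.

(** * The heat semigroup *)

(** The point is the case where [f] has infinite integral: f <= (f + g)^+ + |g| forces the positive
    part of the sum to be infinite, while its negative part is at most |g|, hence integrable. *)
Lemma integralD_ge0_integrable d (T : measurableType d) (R : realType)
    (mu : {measure set T -> \bar R}) (f g : T -> R) :
  measurable_fun setT f -> (forall x, 0 <= f x) ->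
  mu.-integrable setT (EFin \o g) ->
  (\int[mu]_x (f x + g x)%:E = \int[mu]_x (f x)%:E + \int[mu]_x (g x)%:E)%E.
Proof.
move=> mf f0 ig.
have mg : measurable_fun setT g by apply/measurable_EFinP; exact: measurable_int ig.
have f0' x : setT x -> (0 <= (f x)%:E)%E by rewrite lee_fin.
have mEf : measurable_fun setT (EFin \o f) by exact/measurable_EFinP.
have [foo|foo] := ltP (\int[mu]_x (f x)%:E)%E +oo%E.
  rewrite -integralD_EFin //; apply/integrableP; split => //.
  by under eq_integral do rewrite gee0_abs ?lee_fin //=.
move: foo; rewrite leye_eq => /eqP foo.
have iabs : (\int[mu]_x `|(g x)%:E| < +oo)%E by case/integrableP: ig.
have mabs : measurable_fun setT (fun x => `|(g x)%:E|)%E.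
  by apply: measurableT_comp => //; exact/measurable_EFinP.
have mfg : measurable_fun setT (fun x => (f x + g x)%:E).
  by apply/measurable_EFinP; exact: measurable_funD.
have gfin : (\int[mu]_x (g x)%:E)%E \is a fin_num by exact: integrable_fin_num.
rewrite foo addye; last by move: gfin; rewrite fin_numE => /andP[].
have pos : (\int[mu]_x (fun x => (f x + g x)%:E)^\+ x = +oo)%E.
  apply/eqP; rewrite -leye_eq -foo.
  suff : (\int[mu]_x (f x)%:E <= \int[mu]_x (fun x => (f x + g x)%:E)^\+ x +
      \int[mu]_x `|(g x)%:E|)%E.
    rewrite foo !leye_eq => /eqP H; apply/eqP; move: H.
    have /fineK <- : (\int[mu]_x `|(g x)%:E|)%E \is a fin_num.
      by rewrite ge0_fin_numE // integral_ge0.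
    by case: (\int[mu]_x _)%E.
  rewrite -ge0_integralD //; last exact: measurable_funepos.
  apply: ge0_le_integral => //.
    by apply: emeasurable_funD => //; exact: measurable_funepos.
  move=> x _; rewrite funeposE /= -EFin_max lee_fin.
  have H : f x + g x <= Num.max (f x + g x) 0 by rewrite le_max lexx.
  by have := ler_norm (- g x); rewrite normrN; lra.
have neg : (\int[mu]_x (fun x => (f x + g x)%:E)^\- x)%E \is a fin_num.
  rewrite ge0_fin_numE ?integral_ge0 //.
  apply: le_lt_trans iabs; apply: ge0_le_integral => //.
    exact: measurable_funeneg.
  move=> x _; rewrite funenegE /= -EFin_max lee_fin.
  rewrite ge_max normr_ge0 andbT.
  by have := f0 x; have := ler_norm (- g x); rewrite normrN; lra.
rewrite integralE [X in (X - _)%E]pos addye //.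
by move: neg; rewrite -fin_numN fin_numE => /andP[].
Qed.

Section heat.
Context {R : realType}.
Local Notation gauss := (@normal_prob R 0 1).
Variable h : R -> R.
Hypothesis mh : measurable_fun [set: R] h.
Hypothesis h0 : forall x, 0 <= h x.

(** The heat semigroup, with time normalized so that [v] is the variance of the Gaussian increment.
    Values are extended reals because [h] is only assumed nonnegative and measurable. *)
Definition heat (v s : R) : \bar R :=
  (\int[gauss]_z (h (s + Num.sqrt v * z))%:E)%E.

Lemma heat_ge0 v s : (0 <= heat v s)%E.
Proof. by apply: integral_ge0 => z _; rewrite lee_fin. Qed.

Lemma heat0 s : heat 0 s = (h s)%:E.
Proof.
rewrite /heat; under eq_integral do rewrite sqrtr0 mul0r addr0.
by rewrite integral_cst // [X in (_ * X)%E]probability_setT mule1.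
Qed.

Let mhE : measurable_fun [set: R] (EFin \o h).
Proof. exact/measurable_EFinP. Qed.

Lemma measurable_heat v : measurable_fun [set: R] (heat v).
Proof.
apply: (@measurable_fun_fubini_tonelli_F _ _ _ _ _ gauss
  (fun p : R * R => (h (p.1 + Num.sqrt v * p.2))%:E)) => //.
- apply: (measurableT_comp mhE); apply: measurable_funD => //.
  exact: measurable_funM.
- by move=> p; rewrite lee_fin.
Qed.

Lemma heat_conv v w s : 0 <= v -> 0 <= w ->
  (\int[gauss]_z heat w (s + Num.sqrt v * z)%R = heat (v + w) s)%E.
Proof.
move=> v0 w0; pose g x := (h (s + x))%:E.
have mg : measurable_fun [set: R] g.
  by apply: (measurableT_comp mhE); exact: measurable_funD.
have g0 x : (0 <= g x)%E by rewrite lee_fin.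
have := ge0_integral_normal_conv (sqrtr_ge0 v) (sqrtr_ge0 w) mg g0.
rewrite (sqr_sqrtr v0) (sqr_sqrtr w0) /g => H; rewrite /heat -H.
by apply: eq_integral => y _; apply: eq_integral => z _; rewrite addrA.
Qed.

Section heat_step.
Context d (T : measurableType d) (P : probability T R) (X : {RV P >-> R}).

Lemma integral_heat_swap u s :
  (\int[P]_w heat u (s + X w)%R =
   \int[gauss]_z \int[P]_w (h (s + Num.sqrt u * z + X w))%:E)%E.
Proof.
pose F (p : T * measurableTypeR R) := (h (s + Num.sqrt u * p.2 + X p.1))%:E.
have mF : measurable_fun setT F.
  apply: (measurableT_comp mhE); apply: measurable_funD.
    by apply: measurable_funD => //; exact: measurable_funM.
  exact: (measurableT_comp (measurable_funP X)).
have F0 p : (0 <= F p)%E by rewrite lee_fin.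
apply: etrans (fubini_tonelli (m1 := P) (m2 := gauss) F mF F0).
by apply: eq_integral => w _; apply: eq_integral => z _; rewrite /F /= addrAC.
Qed.

(** Since the one-step estimate is uniform in [s], it can be averaged over a Gaussian shift of
    variance [u]. The semigroup law adds the variances, and the constant error [r] is unchanged by
    averaging. *)
Lemma heat_step_le u v r : 0 <= u -> 0 <= v -> 0 <= r ->
  (forall s, \int[P]_w (h (s + X w))%:E <= heat v s + r%:E)%E ->
  (forall s, \int[P]_w heat u (s + X w)%R <= heat (u + v) s + r%:E)%E.
Proof.
move=> u0 v0 r0 H s; rewrite integral_heat_swap -heat_conv //.
have mheat : measurable_fun [set: R] (fun z => heat v (s + Num.sqrt u * z)).
  apply: (measurableT_comp (measurable_heat v)).
  by apply: measurable_funD => //; exact: measurable_funM.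
apply: (@le_trans _ _ (\int[gauss]_z (heat v (s + Num.sqrt u * z) + r%:E))%E).
  apply: ge0_le_integral => //.
  - by move=> z _; apply: integral_ge0 => w _; rewrite lee_fin.
  - apply: (@measurable_fun_fubini_tonelli_G _ _ _ _ _ P (fun p : T * R =>
      (h (s + Num.sqrt u * p.2 + X p.1))%:E)) => //.
      apply: (measurableT_comp mhE); apply: measurable_funD.
        by apply: measurable_funD => //; exact: measurable_funM.
      exact: (measurableT_comp (measurable_funP X)).
    by move=> p; rewrite lee_fin.
  - exact: emeasurable_funD.
rewrite ge0_integralD //; last by move=> z _; exact: heat_ge0.
by rewrite integral_cst // [X in (_ * X)%E]probability_setT mule1.
Qed.

Lemma heat_step_eq u v : 0 <= u -> 0 <= v ->
  (forall s, \int[P]_w (h (s + X w))%:E = heat v s)%E ->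
  (forall s, \int[P]_w heat u (s + X w)%R = heat (u + v) s)%E.
Proof.
move=> u0 v0 H s; rewrite integral_heat_swap -heat_conv //.
by apply: eq_integral => z _; exact: H.
Qed.

End heat_step.
End heat.

(** * One step of the Lindeberg replacement *)

Section moments.
Context (R : realType) (d : measure_display) (T : measurableType d)
  (P : probability T R) (X : {RV P >-> R}).

Let mX : measurable_fun [set: T] X. Proof. exact: measurable_funP. Qed.

Lemma measurable_RV_pow n : measurable_fun [set: T] (fun w => (X w ^+ n)%:E).
Proof. by apply/measurable_EFinP; exact: measurable_funX. Qed.

Lemma measurable_RV_pos_pow n :
  measurable_fun [set: T] (fun w => (Num.max 0 (X w) ^+ n)%:E).
Proof.
apply/measurable_EFinP; apply: measurable_funX.
exact: (@measurable_maxr _ _ _ _ (fun=> 0)).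
Qed.

Lemma integrable_of_sqr : (\int[P]_w (X w ^+ 2)%:E < +oo)%E ->
  P.-integrable setT (EFin \o X).
Proof.
move=> X2; apply/integrableP; split; first exact/measurable_EFinP.
have m2 := measurable_RV_pow 2.
apply: (@le_lt_trans _ _ (\int[P]_w (1 + (X w ^+ 2)%:E))%E); last first.
  rewrite ge0_integralD //; last by move=> w _; rewrite lee_fin sqr_ge0.
  rewrite lte_add_pinfty // integral_cst // [X in (_ * X)%E]probability_setT.
  by rewrite mule1 ltry.
apply: ge0_le_integral => //.
- by apply: measurableT_comp => //; exact/measurable_EFinP.
- exact: emeasurable_funD.
- move=> w _; rewrite /= lee_fin ler_norml; apply/andP; split.
    by have := sqr_ge0 (X w + 1); have := sqr_ge0 (X w); lra.
  by have := sqr_ge0 (X w - 1); have := sqr_ge0 (X w); lra.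
Qed.

Lemma integral_moments_comb (m v t a b k l : R) :
  (\int[P]_w (X w)%:E = m%:E)%E -> (\int[P]_w (X w ^+ 2)%:E = v%:E)%E ->
  (\int[P]_w (Num.max 0 (X w) ^+ 3)%:E = t%:E)%E ->
  (\int[P]_w (a + b * X w + k * X w ^+ 2 + l * Num.max 0 (X w) ^+ 3)%:E =
   (a + b * m + k * v + l * t)%:E)%E.
Proof.
move=> E1 E2 E3.
have i1 : P.-integrable setT (EFin \o X).
  by apply: integrable_of_sqr; rewrite E2 ltry.
have i2 : P.-integrable setT (fun w => (X w ^+ 2)%:E).
  apply/integrableP; split; first exact: measurable_RV_pow.
  under eq_integral do rewrite gee0_abs ?lee_fin ?sqr_ge0 //.
  by rewrite E2 ltry.
have i3 : P.-integrable setT (fun w => (Num.max 0 (X w) ^+ 3)%:E).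
  apply/integrableP; split; first exact: measurable_RV_pos_pow.
  under eq_integral do rewrite gee0_abs ?lee_fin ?exprn_ge0 ?le_max ?lexx //.
  by rewrite E3 ltry.
under eq_integral do rewrite !EFinD !EFinM.
rewrite integralD //; last 2 first.
- apply: integrableD => //; last exact: integrableZl.
  apply: integrableD => //; last exact: integrableZl.
  exact: finite_measure_integrable_cst.
- exact: integrableZl.
rewrite integralD //; last 2 first.
- apply: integrableD => //; last exact: integrableZl.
  exact: finite_measure_integrable_cst.
- exact: integrableZl.
rewrite integralD //; last 2 first.
- exact: finite_measure_integrable_cst.
- exact: integrableZl.
rewrite !integralZl // E1 E2 E3 integral_cst // [X in (_ * X)%E]probability_setT.
by rewrite mule1 -!EFinM -!EFinD.
Qed.

End moments.

Section tilt.
Context (R : realType) (f f1 f2 q : R -> R) (hf : convex3 f f1 f2 q).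

(* [f] minus its tangent at 0 is nonnegative, so Tonelli's theorem applies to
   it without integrability assumptions. *)
Definition tilt (x : R) : R := f x - f 0 - f1 0 * x.

Lemma tilt_ge0 x : 0 <= tilt x.
Proof. by have := c3_tangent hf 0 x; rewrite add0r /tilt; lra. Qed.

Lemma measurable_convex3 : measurable_fun [set: R] f.
Proof.
apply: continuous_measurable_fun => x.
apply/differentiable_continuous/derivable1_diffP.
by have [] := c3_df hf x.
Qed.

Lemma measurable_tilt : measurable_fun [set: R] tilt.
Proof.
apply: measurable_funB; last exact: measurable_funM.
by apply: measurable_funB => //; exact: measurable_convex3.
Qed.

(** Symmetrize in [z], apply [c3_sym] at distance [Num.sqrt v * z], and use that the second moment
    is 1. The quadratic term matches the one in [tilt_le_moments], which is what makes the
    replacement work. *)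
Lemma tilt_le_heat v s : 0 <= v -> ((tilt s + f2 s * v / 2)%:E <= heat tilt v s)%E.
Proof.
move=> v0.
have mt : measurable_fun [set: R] (fun z => (tilt (s + Num.sqrt v * z))%:E).
  apply/measurable_EFinP; apply: (measurableT_comp measurable_tilt).
  by apply: measurable_funD => //; exact: measurable_funM.
have mtN : measurable_fun [set: R] (fun z => (tilt (s + Num.sqrt v * - z))%:E).
  apply/measurable_EFinP; apply: (measurableT_comp measurable_tilt).
  by apply: measurable_funD => //; apply: measurable_funM.
have two : (2%:E * heat tilt v s = \int[normal_prob 0 1]_z
    ((tilt (s + Num.sqrt v * z))%:E + (tilt (s + Num.sqrt v * - z))%:E))%E.
  rewrite ge0_integralD //; try by move=> z _; rewrite lee_fin tilt_ge0.
  rewrite (ge0_integral_normalN mt) ?mule_natl ?mule2n //.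
  by move=> x; rewrite lee_fin tilt_ge0.
have low : ((2 * (tilt s + f2 s * v / 2))%:E <= 2%:E * heat tilt v s)%E.
  rewrite two.
  have -> : (2 * (tilt s + f2 s * v / 2))%:E =
      (\int[normal_prob 0 1]_z ((2 * tilt s)%:E + (f2 s * v)%:E * (z ^+ 2)%:E))%E.
    have fv : 0 <= f2 s * v by rewrite mulr_ge0 // (c3_second_ge0 hf).
    rewrite ge0_integralD //=.
    - rewrite integral_cst // [X in (_ * X)%E]probability_setT mule1.
      rewrite ge0_integralZl // ?normal_second_moment ?mule1 -?EFinD.
      + by congr EFin; field.
      + by apply/measurable_EFinP; exact: exprn_measurable.
      + by move=> z _; rewrite lee_fin sqr_ge0.
    - by move=> z _; rewrite lee_fin mulr_ge0 // tilt_ge0.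
    - by move=> z _; rewrite -EFinM lee_fin mulr_ge0 // sqr_ge0.
    - by apply: measurable_funeM; apply/measurable_EFinP; exact: exprn_measurable.
  apply: ge0_le_integral => //.
  - move=> z _; rewrite -EFinM -EFinD lee_fin; apply: addr_ge0.
      by rewrite mulr_ge0 // tilt_ge0.
    by apply: mulr_ge0; [rewrite mulr_ge0 // (c3_second_ge0 hf)|exact: sqr_ge0].
  - apply: emeasurable_funD => //; apply: measurable_funeM.
    by apply/measurable_EFinP; exact: exprn_measurable.
  - exact: emeasurable_funD.
  - move=> z _; rewrite -EFinM -!EFinD lee_fin /tilt.
    have := c3_sym hf s (Num.sqrt v * z); rewrite exprMn sqr_sqrtr // mulrN.
    lra.
by move: low; rewrite EFinM lee_pmul2l.
Qed.

(** Split time [w] as [v] plus [w - v]: by [tilt_le_heat], running for time [w - v] does not lower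
    [tilt] at any point. *)
Lemma heat_tilt_homo v w s : 0 <= v -> v <= w -> (heat tilt v s <= heat tilt w s)%E.
Proof.
move=> v0 vw; have wv : 0 <= w - v by rewrite subr_ge0.
rewrite -[X in (_ <= heat _ X _)%E](subrKC v).
rewrite -heat_conv //; [|exact: measurable_tilt|exact: tilt_ge0].
have maff : measurable_fun [set: R] (fun z : R => s + Num.sqrt v * z).
  by apply: measurable_funD => //; exact: measurable_funM.
apply: ge0_le_integral => //.
- by move=> z _; rewrite lee_fin tilt_ge0.
- apply/measurable_EFinP; exact: (measurableT_comp measurable_tilt).
- apply: (measurableT_comp _ maff); apply: measurable_heat.
  + exact: measurable_tilt.
  + exact: tilt_ge0.
- move=> z _; apply: le_trans (tilt_le_heat _ wv); rewrite lee_fin lerDl.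
  by rewrite divr_ge0 // mulr_ge0 // (c3_second_ge0 hf).
Qed.

Section tilt_random_variable.
Context d (T : measurableType d) (P : probability T R) (X : {RV P >-> R}).

(** The linear term of the Taylor bound integrates to [(f1 s - f1 0) * m]. The part [f1 s * m] is
    nonpositive and dropped, which removes the dependence on [s]; [- f1 0 * m] is kept as an error
    that cancels later. *)
Lemma tilt_le_moments (c m v t s : R) : 0 <= c -> (forall x, q x <= c) ->
  (\int[P]_w (X w)%:E = m%:E)%E -> (\int[P]_w (X w ^+ 2)%:E = v%:E)%E ->
  (\int[P]_w (Num.max 0 (X w) ^+ 3)%:E = t%:E)%E -> m <= 0 ->
  (\int[P]_w (tilt (s + X w))%:E <=
   (tilt s + f2 s * v / 2 + (c * t / 6 - f1 0 * m))%:E)%E.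
Proof.
move=> c0 qc E1 E2 E3 m0.
have lip x y : x <= y -> f2 y - f2 x <= c * (y - x).
  move=> xy; have [_ H] := c3_slope hf xy; apply: (le_trans H).
  by rewrite ler_wpM2r ?subr_ge0.
apply: (@le_trans _ _ (\int[P]_w (tilt s + (f1 s - f1 0) * X w +
    f2 s / 2 * X w ^+ 2 + c / 6 * Num.max 0 (X w) ^+ 3)%:E)%E).
  apply: ge0_le_integral => //.
  - by move=> w _; rewrite lee_fin tilt_ge0.
  - apply/measurable_EFinP; apply: (measurableT_comp measurable_tilt).
    exact: measurable_funD.
  - apply/measurable_EFinP; apply: measurable_funD.
      apply: measurable_funD.
        by apply: measurable_funD => //; exact: measurable_funM.
      apply: measurable_funM => //; exact: measurable_funX.
    by apply: measurable_funM => //; apply/measurable_EFinP;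
      exact: measurable_RV_pos_pow.
  - move=> w _; rewrite lee_fin /tilt.
    by have := c3_taylor_le hf s (X w) c0 lip; lra.
rewrite (integral_moments_comb _ _ _ _ E1 E2 E3) lee_fin.
have := mulr_ge0_le0 (c3_first_ge0 hf s) m0.
lra.
Qed.

Lemma tilt_le_heat_moments (c m v t s : R) : 0 <= c -> (forall x, q x <= c) ->
  (\int[P]_w (X w)%:E = m%:E)%E -> (\int[P]_w (X w ^+ 2)%:E = v%:E)%E ->
  (\int[P]_w (Num.max 0 (X w) ^+ 3)%:E = t%:E)%E -> m <= 0 -> 0 <= v ->
  (\int[P]_w (tilt (s + X w))%:E <= heat tilt v s + (c * t / 6 - f1 0 * m)%:E)%E.
Proof.
move=> c0 qc E1 E2 E3 m0 v0.
apply: (le_trans (tilt_le_moments s c0 qc E1 E2 E3 m0)).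
by rewrite EFinD leeD2r // tilt_le_heat.
Qed.

End tilt_random_variable.
End tilt.

(** * The upper bound *)

Section heat_sum.
Context (R : realType) (h : R -> R).
Hypothesis mh : measurable_fun [set: R] h.
Hypothesis h0 : forall x, 0 <= h x.
Context (d : measure_display) (T : measurableType d) (P : probability T R)
  (n : nat) (X : 'I_n -> {RV P >-> R}) (indX : mutually_independent X).

Lemma partial_sum0 w : partial_sum X 0 w = 0.
Proof. by rewrite /partial_sum big_pred0. Qed.

(** The summand of highest index is integrated out first and lengthens the time by its variance, so
    the induction on [k] needs [u] universally quantified. *)
Lemma heat_sum_le (v r : 'I_n -> R) : (forall i, 0 <= v i) ->
  (forall i, 0 <= r i) ->
  (forall i s, \int[P]_w (h (s + X i w))%:E <= heat h (v i) s + (r i)%:E)%E ->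
  forall k, (k <= n)%N -> forall u, 0 <= u ->
  (\int[P]_w heat h u (partial_sum X k w) <=
   heat h (u + \sum_(i < n | (i < k)%N) v i) 0
     + (\sum_(i < n | (i < k)%N) r i)%:E)%E.
Proof.
move=> v0 r0 H; elim=> [_|k IH kn] u u0.
  rewrite !big_pred0 //. rewrite !addr0.
  under eq_integral do rewrite partial_sum0.
  by rewrite integral_cst // [X in (_ * X)%E]probability_setT mule1.
rewrite (integral_partial_sumS indX kn); last 2 first.
- exact: measurable_heat.
- by move=> x; exact: heat_ge0.
set i := Ordinal kn.
have step := heat_step_le mh h0 u0 (v0 i) (r0 i) (H i).
have mS := measurable_partial_sum X k.
have mheat : measurable_fun setT (fun w => heat h (u + v i) (partial_sum X k w)).
  by apply: (measurableT_comp _ mS); exact: measurable_heat.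
apply: (@le_trans _ _ (\int[P]_w
    (heat h (u + v i) (partial_sum X k w) + (r i)%:E))%E).
  apply: ge0_le_integral => //.
  - by move=> w _; apply: integral_ge0 => w' _; exact: heat_ge0.
  - apply: (@measurable_fun_fubini_tonelli_F _ _ _ _ _ P (fun p : T * T =>
      heat h u (partial_sum X k p.1 + X i p.2))).
      apply: (measurableT_comp (measurable_heat mh h0 u)).
      apply: measurable_funD; first exact: (measurableT_comp mS).
      exact: (measurableT_comp (measurable_funP (X i))).
    by move=> p; exact: heat_ge0.
  - exact: emeasurable_funD.
rewrite ge0_integralD //; last 2 first.
- by move=> w _; exact: heat_ge0.
- by move=> w _; rewrite lee_fin.
rewrite integral_cst // [X in (_ * X)%E]probability_setT mule1.
rewrite (sum_ltnS kn v) (sum_ltnS kn r) EFinD addeA.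
rewrite leeD2r //.
have uvA (A : R) : u + (A + v i) = u + v i + A by ring.
by rewrite uvA; exact: IH (ltnW kn) (u + v i) (addr_ge0 u0 (v0 i)).
Qed.

(** The exact counterpart for Gaussian summands. The summand of index 0 is left in place, because it
    will be the jump. *)
Lemma heat_sum_eq (v : R) : 0 <= v ->
  (forall i : 'I_n, (0 < i)%N -> forall s,
     \int[P]_w (h (s + X i w))%:E = heat h v s)%E ->
  forall k, (k < n)%N -> forall u, 0 <= u ->
  (\int[P]_w heat h u (partial_sum X k.+1 w) =
   \int[P]_w heat h (u + k%:R * v) (partial_sum X 1 w))%E.
Proof.
move=> v0 H; elim=> [_|k IH kn] u u0; first by rewrite mul0r addr0.
rewrite (integral_partial_sumS indX kn); last 2 first.
- exact: measurable_heat.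
- by move=> x; exact: heat_ge0.
have step := heat_step_eq mh h0 u0 v0 (H (Ordinal kn) isT).
under eq_integral do rewrite step.
have -> : u + k.+1%:R * v = u + v + k%:R * v by rewrite -nat1r; ring.
exact: IH (ltnW kn) (u + v) (addr_ge0 u0 v0).
Qed.

End heat_sum.

Lemma expectationE d (T : measurableType d) (R : realType) (P : probability T R)
  (X : T -> R) : ('E_P[X] = \int[P]_w (X w)%:E)%E.
Proof. by rewrite unlock. Qed.

Section upper_bound.
Context (R : realType) (f f1 f2 q : R -> R) (hf : convex3 f f1 f2 q).
Context (d : measure_display) (T : measurableType d) (P : probability T R).

Lemma expectation_tilt (S : T -> R) (m : R) : measurable_fun setT S ->
  P.-integrable setT (EFin \o S) -> (\int[P]_w (S w)%:E = m%:E)%E ->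
  ('E_P[fun w => f (S w)] =
   \int[P]_w (tilt f f1 (S w))%:E + (f 0 + f1 0 * m)%:E)%E.
Proof.
move=> mS iS ES; rewrite expectationE.
have iK : P.-integrable setT (fun w => (f1 0 * S w)%:E).
  by under eq_fun do rewrite EFinM; exact: integrableZl.
have i0 : P.-integrable setT (fun w => (f 0)%:E).
  exact: finite_measure_integrable_cst.
transitivity (\int[P]_w (tilt f f1 (S w) + (f 0 + f1 0 * S w))%:E)%E.
  by apply: eq_integral => w _; congr EFin; rewrite /tilt; ring.
rewrite integralD_ge0_integrable.
- congr (_ + _)%E; under eq_integral do rewrite EFinD.
  rewrite integralD // integral_cst // [X in (_ * X)%E]probability_setT mule1.
  under eq_integral do rewrite EFinM.
  by rewrite integralZl // ES -EFinM -EFinD.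
- exact: (measurableT_comp (measurable_tilt hf)).
- by move=> w; exact: (tilt_ge0 hf).
- rewrite (_ : _ \o _ = (fun w => (f 0)%:E + (f1 0 * S w)%:E)%E) //.
  exact: integrableD.
Qed.

Lemma sum_expectation (n : nat) (X : 'I_n -> {RV P >-> R}) :
  (forall i, P.-integrable setT (EFin \o X i)) ->
  P.-integrable setT (fun w => (\sum_(i < n) X i w)%:E) /\
  (\int[P]_w (\sum_(i < n) X i w)%:E =
   (\sum_(i < n) fine (\int[P]_w (X i w)%:E))%:E)%E.
Proof.
move=> iX.
have E w : (\sum_(i < n) X i w)%:E = (\sum_(i < n) (X i w)%:E)%E.
  by rewrite sumEFin.
split.
  by under eq_fun do rewrite E; apply: integrable_sum => // i _; exact: iX.
under eq_integral do rewrite E.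
rewrite integral_sum // -sumEFin; apply: eq_bigr => i _.
by rewrite fineK //; exact: integrable_fin_num (iX i).
Qed.

Lemma sum_ge0_fin (n : nat) (a : 'I_n -> \bar R) (b : R) :
  (forall i, 0 <= a i)%E -> (\sum_(i < n) a i <= b%:E)%E ->
  (forall i, a i \is a fin_num) /\ \sum_(i < n) fine (a i) <= b.
Proof.
move=> a0 ab.
have afin i : a i \is a fin_num.
  rewrite ge0_fin_numE //; apply: le_lt_trans (ltry b); apply: le_trans ab.
  by rewrite (bigD1 i) //= leeDl // sume_ge0.
split=> //; rewrite -lee_fin -sumEFin; apply: le_trans ab.
by apply: lee_sum => i _; rewrite fineK.
Qed.

Lemma upper_bound (beta c : R) (n : nat) (X : 'I_n -> {RV P >-> R}) :
  admissible beta X -> 0 <= c -> (forall x, q x <= c) ->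
  ('E_P[fun w => f (\sum_(i < n) X i w)] <=
   heat (tilt f f1) 1 0 + (f 0)%:E + (c / 6 * beta)%:E)%E.
Proof.
move=> [indX EX EX2 EX3] c0 qc.
have [fin2 sum2] : (forall i, \int[P]_w (X i w ^+ 2)%:E \is a fin_num)%E /\
    \sum_(i < n) fine (\int[P]_w (X i w ^+ 2)%:E)%E <= 1.
  apply: sum_ge0_fin.
    by move=> i; apply: integral_ge0 => w _; rewrite lee_fin sqr_ge0.
  by move: EX2; under eq_bigr do rewrite expectationE.
have [fin3 sum3] :
    (forall i, \int[P]_w (Num.max 0 (X i w) ^+ 3)%:E \is a fin_num)%E /\
    \sum_(i < n) fine (\int[P]_w (Num.max 0 (X i w) ^+ 3)%:E)%E <= beta.
  apply: sum_ge0_fin.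
    move=> i; apply: integral_ge0 => w _.
    by rewrite lee_fin exprn_ge0 // le_max lexx.
  by move: EX3; under eq_bigr do rewrite expectationE.
pose v i := fine (\int[P]_w (X i w ^+ 2)%:E)%E.
pose t i := fine (\int[P]_w (Num.max 0 (X i w) ^+ 3)%:E)%E.
pose m i := fine (\int[P]_w (X i w)%:E)%E.
have v0 i : 0 <= v i.
  by rewrite fine_ge0 // integral_ge0 // => w _; rewrite lee_fin sqr_ge0.
have t0 i : 0 <= t i.
  rewrite fine_ge0 // integral_ge0 // => w _.
  by rewrite lee_fin exprn_ge0 // le_max lexx.
have iX i : P.-integrable setT (EFin \o X i).
  by apply: integrable_of_sqr; rewrite ltey_eq fin2.
have E1 i : (\int[P]_w (X i w)%:E = (m i)%:E)%E.
  by rewrite fineK //; exact: integrable_fin_num (iX i).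
have m0 i : m i <= 0 by have := EX i; rewrite expectationE E1 lee_fin.
have [iS ES] := sum_expectation iX.
have mS : measurable_fun setT (fun w => \sum_(i < n) X i w).
  exact: measurable_sum.
rewrite (expectation_tilt mS iS ES).
have K0 := c3_first_ge0 hf 0.
pose r i := c * t i / 6 - f1 0 * m i.
have r0 i : 0 <= r i.
  rewrite subr_ge0 (@le_trans _ _ 0) ?mulr_ge0_le0 //.
  by rewrite !mulr_ge0.
have mt := measurable_tilt hf; have tp := tilt_ge0 hf.
have H i s : (\int[P]_w (tilt f f1 (s + X i w))%:E <=
    heat (tilt f f1) (v i) s + (r i)%:E)%E.
  apply: (tilt_le_heat_moments hf s c0 qc (E1 i) _ _ (m0 i) (v0 i));
    by rewrite fineK.
have := @heat_sum_le _ _ mt tp _ _ _ _ _ indX v r v0 r0 H n (leqnn n) 0 (lexx 0).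
have all (F : 'I_n -> R) : \sum_(i < n | (i < n)%N) F i = \sum_(i < n) F i.
  by apply: eq_bigl => i; rewrite ltn_ord.
rewrite add0r !all.
under eq_integral do rewrite heat0 partial_sum_all.
move=> main; have {}main : (\int[P]_w (tilt f f1 (\sum_(i < n) X i w))%:E <=
    heat (tilt f f1) 1 0 + (\sum_(i < n) r i)%:E)%E.
  by apply: (le_trans main); rewrite leeD2r // (heat_tilt_homo hf) // sumr_ge0.
apply: (le_trans (leeD2r _ main)).
move: (heat (tilt f f1) 1 0) => Q {main}.
rewrite -!addeA; apply: leeD2l; rewrite -!EFinD lee_fin.
(* The second sum cancels [f1 0] times the mean of S, which came from adding the affine part
   back. *)
have -> : \sum_(i < n) r i = c / 6 * \sum_(i < n) t i - f1 0 * \sum_(i < n) m i.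
  by rewrite /r sumrB !mulr_sumr; congr (_ - _); apply: eq_bigr => i _; ring.
have := ler_wpM2l (divr_ge0 c0 (ler0n R 6)) sum3; rewrite -/t /m; lra.
Qed.

End upper_bound.

(** * The extremal family *)

Lemma integral_law d (T : measurableType d) (R : realType) (P : probability T R)
    (Q : probability R R) (X : {RV P >-> R}) :
  (forall A, measurable A -> P (X @^-1` A) = Q A) ->
  forall g : R -> \bar R, measurable_fun [set: R] g ->
  (\int[P]_w g (X w) = \int[Q]_x g x)%E.
Proof.
move=> law g mg.
have E k : measurable_fun [set: R] k -> (forall x, 0 <= k x)%E ->
    (\int[P]_w k (X w) = \int[Q]_x k x)%E.
  move=> mk k0; rewrite -[LHS](ge0_integral_distribution X mk k0).
  by apply: eq_measure_integral => A mA _; exact: law.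
rewrite integralE [RHS]integralE.
congr (_ - _)%E.
- apply: etrans (E _ (measurable_funepos mg) _) => [|//].
  by apply: eq_integral => w _; rewrite !funeposE.
- apply: etrans (E _ (measurable_funeneg mg) _) => [|//].
  by apply: eq_integral => w _; rewrite !funenegE.
Qed.

Section two_point.
Context (R : realType) (p a b : R).
Hypothesis p01 : 0 <= p <= 1.
Hypothesis a0 : 0 <= a.
Hypothesis b0 : 0 <= b.

Definition two_point_fun (x : bool) : R := if x then a else - b.

Lemma measurable_two_point : measurable_fun [set: bool] two_point_fun.
Proof. by []. Qed.

Definition two_point_RV : {RV (bernoulli_prob p : probability bool R) >-> R} :=
  mfun_Sub (mem_set measurable_two_point).

Definition two_point : probability R R :=
  distribution (bernoulli_prob p) two_point_RV.

Lemma ge0_integral_two_point (g : R -> \bar R) : measurable_fun [set: R] g ->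
  (forall x, 0 <= g x)%E ->
  (\int[two_point]_x g x = p%:E * g a + (1 - p)%:E * g (- b)%R)%E.
Proof.
move=> mg g0; rewrite ge0_integral_distribution //.
by rewrite integral_bernoulli_prob //= => x.
Qed.

Lemma mean_two_point : p * a = (1 - p) * b -> (\int[two_point]_x x%:E = 0)%E.
Proof.
move=> pab; have mid : measurable_fun [set: R] (@EFin R) by exact/measurable_EFinP.
rewrite integralE !ge0_integral_two_point //;
  [|exact: measurable_funeneg|exact: measurable_funepos].
rewrite !funeposE !funenegE -!EFinN -!EFin_max opprK.
rewrite (max_idPl a0) (max_idPl b0).
have -> : Num.max (- b) 0 = 0 by apply/max_idPr; rewrite oppr_le0.
have -> : Num.max (- a) 0 = 0 by apply/max_idPr; rewrite oppr_le0.
by rewrite !mule0 addr0 add0r -!EFinM -EFinB pab subrr.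
Qed.

End two_point.

Section scaled_gauss.
Context (R : realType) (s : R).

Lemma measurable_scale : measurable_fun [set: measurableTypeR R]
  (fun x : measurableTypeR R => s * x : R).
Proof. exact: measurable_funM. Qed.

Definition scale_RV :
    {RV (normal_prob 0 1 : probability (measurableTypeR R) R) >-> R} :=
  mfun_Sub (mem_set measurable_scale).

Definition scaled_gauss : probability R R :=
  distribution (normal_prob 0 1) scale_RV.

Lemma ge0_integral_scaled_gauss (g : R -> \bar R) : measurable_fun [set: R] g ->
  (forall x, 0 <= g x)%E ->
  (\int[scaled_gauss]_x g x = \int[normal_prob 0 1]_z g (s * z)%R)%E.
Proof. by move=> mg g0; rewrite ge0_integral_distribution. Qed.

Lemma mean_scaled_gauss : (\int[scaled_gauss]_x x%:E = 0)%E.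
Proof.
have iid := @normal_integrable_id R.
rewrite integral_distribution //; last first.
  rewrite (_ : _ \o _ = (fun z : R => s%:E * z%:E)%E) //.
  exact: integrableZl.
under eq_integral do rewrite /= EFinM.
by rewrite integralZl // normal_first_moment mule0.
Qed.

Lemma second_moment_scaled_gauss :
  (\int[scaled_gauss]_x (x ^+ 2)%:E = (s ^+ 2)%:E)%E.
Proof.
have m2 : measurable_fun [set: R] (fun x : R => (x ^+ 2)%:E).
  by apply/measurable_EFinP; exact: exprn_measurable.
rewrite ge0_integral_scaled_gauss //; last by move=> x; rewrite lee_fin sqr_ge0.
under eq_integral do rewrite exprMn EFinM.
rewrite ge0_integralZl ?normal_second_moment ?mule1 ?lee_fin ?sqr_ge0 //.
by move=> z _; rewrite lee_fin sqr_ge0.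
Qed.

Lemma third_moment_scaled_gauss : 0 <= s ->
  (\int[scaled_gauss]_x (Num.max 0 x ^+ 3)%:E =
   (s ^+ 3)%:E * \int[normal_prob 0 1]_z (Num.max 0 z ^+ 3)%:E)%E.
Proof.
move=> s0; have m3 : measurable_fun [set: R] (fun x : R => (Num.max 0 x ^+ 3)%:E).
  apply/measurable_EFinP; apply: measurable_funX.
  exact: (@measurable_maxr _ _ _ _ (fun=> 0)).
rewrite ge0_integral_scaled_gauss //; last first.
  by move=> x; rewrite lee_fin exprn_ge0 // le_max lexx.
rewrite -ge0_integralZl ?lee_fin ?exprn_ge0 //; last first.
  by move=> x _; rewrite lee_fin exprn_ge0 // le_max lexx.
apply: eq_integral => z _; rewrite -EFinM -exprMn; congr (_ ^+ 3)%:E.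
by rewrite maxr_pMr // mulr0.
Qed.

End scaled_gauss.

(** Names membership in the set whose supremum the theorem takes. *)
Definition attained (R : realType) (beta : R) (f : R -> R) (e : \bar R) : Prop :=
  exists (n : nat) (d : measure_display) (T : measurableType d)
    (P : probability T R) (X : 'I_n -> {RV P >-> R}),
    [/\ (0 < n)%N, admissible beta X &
        e = 'E_P[fun w => f (\sum_(i < n) X i w)%R]%E].

Section extremal_family.
Context (R : realType) (f f1 f2 q : R -> R) (hf : convex3 f f1 f2 q).
Local Notation gauss := (@normal_prob R 0 1).
Let h := tilt f f1.
Let mt : measurable_fun [set: R] h := measurable_tilt hf.
Let tp : forall x, 0 <= h x := tilt_ge0 hf.

(** The expectation is computed exactly and does not depend on [n]: given the jump, the Gaussian
    summands amount to running [heat] for time [tau]. The number [n] only has to make their third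
    moments, [tau * C * s] in total, fit into [beta - p * a ^+ 3]. *)
Lemma attained_jump_gauss (beta p a b tau : R) : 0 < p < 1 -> 0 <= a -> 0 <= b ->
  p * a = (1 - p) * b -> 0 <= tau ->
  p * a ^+ 2 + (1 - p) * b ^+ 2 + tau <= 1 -> p * a ^+ 3 < beta ->
  attained beta f
    (p%:E * heat h tau a + (1 - p)%:E * heat h tau (- b)%R + (f 0)%:E)%E.
Proof.
move=> /andP[p0 p1] a0 b0 pab tau0 var third.
have p01 : 0 <= p <= 1 by rewrite !ltW.
pose C := fine (\int[gauss]_z (Num.max 0 z ^+ 3)%:E)%E.
have CE : (\int[gauss]_z (Num.max 0 z ^+ 3)%:E)%E = C%:E.
  rewrite fineK // ge0_fin_numE ?normal_third_moment_lty //.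
  by apply: integral_ge0 => z _; rewrite lee_fin exprn_ge0 // le_max lexx.
have C0 : 0 <= C.
  rewrite fine_ge0 // integral_ge0 // => z _.
  by rewrite lee_fin exprn_ge0 // le_max lexx.
(* Largest admissible scale of one Gaussian summand; the added 1 keeps the denominator positive when
   [tau * C] vanishes. *)
pose eta := (beta - p * a ^+ 3) / (tau * C + 1).
have eta0 : 0 < eta by rewrite divr_gt0 ?subr_gt0 // ltr_wpDl // mulr_ge0.
have [n [n0 nlarge]] : exists n, (0 < n)%N /\ tau / n%:R <= eta ^+ 2.
  exists (Num.truncn (tau / eta ^+ 2)).+1; split => //.
  rewrite ler_pdivrMr ?ltr0n // mulrC -ler_pdivrMr ?exprn_gt0 //.
  exact/ltW/truncnS_gt.
have nR0 : 0 < n%:R :> R by rewrite ltr0n.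
pose v := tau / n%:R.
have v0 : 0 <= v by rewrite divr_ge0 // ltW.
pose s := Num.sqrt v.
have s0 : 0 <= s by exact: sqrtr_ge0.
have s2 : s ^+ 2 = v by rewrite sqr_sqrtr.
have seta : s <= eta by rewrite -(@ler_pXn2r _ 2) ?nnegrE // ?s2 // ltW.
pose Q (i : nat) := if i is 0%N then two_point p a b else scaled_gauss s.
have [d [T [P [X [indX lawX]]]]] := exists_independent n.+1 Q.
have mid : measurable_fun [set: R] (fun x : R => x%:E) by exact/measurable_EFinP.
have m2 : measurable_fun [set: R] (fun x : R => (x ^+ 2)%:E).
  by apply/measurable_EFinP; exact: exprn_measurable.
have m3 : measurable_fun [set: R] (fun x : R => (Num.max 0 x ^+ 3)%:E).
  apply/measurable_EFinP; apply: measurable_funX.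
  exact: (@measurable_maxr _ _ _ _ (fun=> 0)).
have law0 := integral_law (lawX ord0).
have lawS (i : 'I_n) : forall A, measurable A ->
    P (X (lift ord0 i) @^-1` A) = scaled_gauss s A by exact: (lawX (lift ord0 i)).
have mean i : (\int[P]_w (X i w)%:E = 0)%E.
  case: (unliftP ord0 i) => [j ->|->].
    by rewrite (integral_law (lawS j) mid) mean_scaled_gauss.
  by rewrite (law0 _ mid) mean_two_point.
have sq0 : (\int[P]_w (X ord0 w ^+ 2)%:E = (p * a ^+ 2 + (1 - p) * b ^+ 2)%:E)%E.
  rewrite (law0 _ m2) ge0_integral_two_point //; last first.
    by move=> x; rewrite lee_fin sqr_ge0.
  by rewrite sqrrN EFinD !EFinM.
have sqS (i : 'I_n) : (\int[P]_w (X (lift ord0 i) w ^+ 2)%:E = v%:E)%E.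
  by rewrite (integral_law (lawS i) m2) second_moment_scaled_gauss s2.
have cu0 : (\int[P]_w (Num.max 0 (X ord0 w) ^+ 3)%:E = (p * a ^+ 3)%:E)%E.
  rewrite (law0 _ m3) ge0_integral_two_point //; last first.
    by move=> x; rewrite lee_fin exprn_ge0 // le_max lexx.
  rewrite (max_idPr a0); have -> : Num.max 0 (- b) = 0.
    by apply/max_idPl; rewrite oppr_le0.
  by rewrite expr0n /= mule0 adde0.
have cuS (i : 'I_n) :
    (\int[P]_w (Num.max 0 (X (lift ord0 i) w) ^+ 3)%:E = (s ^+ 3 * C)%:E)%E.
  by rewrite (integral_law (lawS i) m3) third_moment_scaled_gauss // CE.
have nv : n%:R * v = tau by rewrite /v; field; rewrite gt_eqF.
exists n.+1, d, T, P, X; split => //.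
  split => //.
  - by move=> i; rewrite expectationE mean.
  - rewrite big_ord_recl expectationE sq0.
    under eq_bigr do rewrite expectationE sqS.
    rewrite sumEFin -EFinD lee_fin sumr_const card_ord -mulr_natl nv.
    exact: var.
  - rewrite big_ord_recl expectationE cu0.
    under eq_bigr do rewrite expectationE cuS.
    rewrite sumEFin -EFinD lee_fin sumr_const card_ord -mulr_natl.
    have -> : n%:R * (s ^+ 3 * C) = tau * C * s by rewrite -nv -s2; ring.
    have tC : 0 <= tau * C by rewrite mulr_ge0.
    have := ler_wpM2l tC seta.
    have : (tau * C + 1) * eta = beta - p * a ^+ 3.
      by rewrite /eta; field; rewrite gt_eqF // ltr_wpDl.
    by have := eta0; lra.
have iX i : P.-integrable setT (EFin \o X i).
  apply: integrable_of_sqr; case: (unliftP ord0 i) => [j ->|->].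
    by rewrite sqS ltry.
  by rewrite sq0 ltry.
have [iS ES] := sum_expectation iX.
have mS : measurable_fun setT (fun w => \sum_(i < n.+1) X i w).
  exact: measurable_sum.
rewrite (expectation_tilt hf mS iS ES).
rewrite big1 ?mulr0 ?addr0 => [|i _]; last by rewrite mean.
congr (_ + _)%E.
have gaussX (i : 'I_n.+1) : (0 < i)%N -> forall y,
    (\int[P]_w (h (y + X i w))%:E = heat h v y)%E.
  case: (unliftP ord0 i) => [j -> _ y|-> //].
  have mhy : measurable_fun [set: R] (fun x => (h (y + x))%:E).
    by apply/measurable_EFinP; apply: (measurableT_comp mt); exact: measurable_funD.
  rewrite (integral_law (lawS j) mhy) ge0_integral_scaled_gauss //.
  by move=> x; rewrite lee_fin.
have := heat_sum_eq mt tp indX v0 gaussX (ltnSn n) (lexx 0).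
rewrite add0r nv.
under eq_integral do rewrite heat0 partial_sum_all.
under [in X in _ = X -> _]eq_integral do
  rewrite (partial_sumS _ (ltn0Sn n)) partial_sum0 add0r.
move=> ->.
have -> : Ordinal (ltn0Sn n) = ord0 by exact: val_inj.
rewrite (law0 (heat h tau) (measurable_heat mt tp tau)) ge0_integral_two_point //.
- exact: measurable_heat.
- by move=> x; exact: heat_ge0.
Qed.

End extremal_family.

(** * Lower estimates for the jump and for the Gaussian part *)

Section lower_estimates.
Context (R : realType) (f f1 f2 q : R -> R) (hf : convex3 f f1 f2 q).
Local Notation gauss := (@normal_prob R 0 1).
Let h := tilt f f1.
Let mt : measurable_fun [set: R] h := measurable_tilt hf.
Let tp : forall x, 0 <= h x := tilt_ge0 hf.

(** To the right of [x0 >= 0] the tangent at [x0] lies above the tangent at 0; adding the tangent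
    inequalities at the two points gives [f1 0 <= f1 x0] when [x0 > 0]. *)
Lemma tilt_cubic_growth x0 a : 0 <= x0 -> x0 <= a ->
  q x0 * (a - x0) ^+ 3 / 6 <= h a.
Proof.
move=> x00 x0a; have d0 : 0 <= a - x0 by rewrite subr_ge0.
have := c3_cubic_growth hf x0 d0; rewrite subrKC => grow.
have t0 := c3_tangent hf 0 x0; rewrite add0r in t0.
have tx := c3_tangent hf x0 (- x0); rewrite subrr in tx.
have f1x0 : f1 0 * (a - x0) <= f1 x0 * (a - x0).
  move: x00; rewrite le_eqVlt => /predU1P[<-//|x00].
  have : f1 0 * x0 <= f1 x0 * x0 by lra.
  by rewrite ler_pM2r // => H; rewrite ler_wpM2r.
by rewrite /h /tilt; lra.
Qed.

Lemma tilt_convex t x y : 0 <= t <= 1 ->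
  h (t * x + (1 - t) * y) <= t * h x + (1 - t) * h y.
Proof. by move=> /(c3_convex hf x y); rewrite /h /tilt; lra. Qed.

(* With [l = 1 / (1 + k)] and [t = b / k] in [0, 1], the point z is the convex
   combination of (1 - k) z - b and 2 z + t with weights l and 1 - l. *)
Lemma tilt_shrink k b z : 0 < k -> k <= 1 -> 0 <= b -> b <= k ->
  (1 + k) * h z <= h (- b + (1 - k) * z) + k * (h (2 * z) + h (2 * z + 1)).
Proof.
move=> k0 k1 b0 bk.
have kN0 : k != 0 by rewrite gt_eqF.
have k1N0 : 1 + k != 0 by rewrite gt_eqF //; lra.
have t01 : 0 <= b / k <= 1.
  by apply/andP; split; [rewrite divr_ge0 // ltW|rewrite ler_pdivrMr // mul1r].
have H1 := tilt_convex (2 * z + 1) (2 * z) t01.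
have E1 : b / k * (2 * z + 1) + (1 - b / k) * (2 * z) = 2 * z + b / k by ring.
rewrite E1 in H1.
have H2 : h (2 * z + b / k) <= h (2 * z) + h (2 * z + 1).
  case/andP: t01 => t0 t1.
  have t1' : 0 <= 1 - b / k by rewrite subr_ge0.
  have := mulr_ge0 t0 (tp (2 * z)); have := mulr_ge0 t1' (tp (2 * z + 1)).
  by lra.
have l01 : 0 <= (1 + k)^-1 <= 1.
  by apply/andP; split; [rewrite invr_ge0; lra|rewrite invf_le1; lra].
have H3 := tilt_convex (- b + (1 - k) * z) (2 * z + b / k) l01.
have E3 : (1 + k)^-1 * (- b + (1 - k) * z) + (1 - (1 + k)^-1) * (2 * z + b / k) = z.
  by field; rewrite kN0 k1N0.
rewrite E3 in H3.
have k1p : 0 <= 1 + k by lra.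
have := ler_wpM2l k1p H3.
have -> : (1 + k) * ((1 + k)^-1 * h (- b + (1 - k) * z) +
     (1 - (1 + k)^-1) * h (2 * z + b / k)) =
   h (- b + (1 - k) * z) + k * h (2 * z + b / k) by field.
have := ler_wpM2l (ltW k0) H2.
lra.
Qed.

(** By convexity the integrand dominates [h (2 * z + t)] for all [t] in [0, 1]. Being free of [k]
    and [b], it turns the error of [heat_shrink] into [k] times a constant. *)
Definition tilt_majorant : \bar R :=
  (\int[gauss]_z (h (2 * z) + h (2 * z + 1))%:E)%E.

Let mh_affine (m s : R) : measurable_fun [set: R] (fun z => (h (m + s * z))%:E).
Proof.
by apply/measurable_EFinP; apply: (measurableT_comp mt); exact: measurable_affine.
Qed.

Let mmaj : measurable_fun [set: R] (fun z => (h (2 * z) + h (2 * z + 1))%:E).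
Proof.
apply: eq_measurable_fun (emeasurable_funD (mh_affine 0 2) (mh_affine 1 2)).
by move=> z _; rewrite /= add0r [1 + _]addrC.
Qed.

(** [tilt_shrink] averaged over [z]: a quantitative lower semicontinuity at variance 1 and centre 0,
    stated without subtraction because the terms may be +oo. *)
Lemma heat_shrink k b : 0 < k -> k <= 1 -> 0 <= b -> b <= k ->
  ((1 + k)%:E * heat h 1 0 <=
   heat h ((1 - k) ^+ 2) (- b)%R + k%:E * tilt_majorant)%E.
Proof.
move=> k0 k1 b0 bk; have k1p : 0 <= 1 + k by lra.
have s : Num.sqrt ((1 - k) ^+ 2) = 1 - k by rewrite sqrtr_sqr ger0_norm //; lra.
rewrite /heat /tilt_majorant s.
under eq_integral do rewrite sqrtr1 add0r mul1r.
have mhz : measurable_fun [set: R] (fun z => (h z)%:E) by exact/measurable_EFinP.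
have maj0 z : (0 <= (h (2 * z) + h (2 * z + 1))%:E)%E by rewrite lee_fin addr_ge0.
have -> : ((1 + k)%:E * \int[gauss]_z (h z)%:E =
    \int[gauss]_z ((1 + k)%:E * (h z)%:E))%E.
  by rewrite ge0_integralZl // => z _; rewrite lee_fin.
have -> : (k%:E * \int[gauss]_z (h (2 * z) + h (2 * z + 1))%:E =
    \int[gauss]_z (k%:E * (h (2 * z) + h (2 * z + 1))%:E))%E.
  by rewrite ge0_integralZl // lee_fin ltW.
have mkmaj : measurable_fun [set: R]
    (fun z => (k%:E * (h (2 * z) + h (2 * z + 1))%:E)%E).
  exact: measurable_funeM.
rewrite -ge0_integralD //; last 3 first.
- by move=> z _; rewrite lee_fin.
- exact: mh_affine.
- by move=> z _; rewrite mule_ge0 // lee_fin ltW.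
apply: ge0_le_integral => //.
- by move=> z _; rewrite -EFinM lee_fin mulr_ge0.
- exact: measurable_funeM.
- by apply: emeasurable_funD => //; exact: mh_affine.
- by move=> z _; rewrite -!EFinM -EFinD lee_fin tilt_shrink.
Qed.

(** The Taylor bound [tilt_le_moments], applied to a normal variable of scale [s], has a finite
    right-hand side. *)
Lemma integral_tilt_scaled_lty c m s : 0 <= s -> 0 <= c -> (forall x, q x <= c) ->
  (\int[gauss]_z (h (m + s * z))%:E < +oo)%E.
Proof.
move=> s0 c0 qc.
have idRV : measurable_fun [set: R] (fun x : R => x) by [].
pose X : {RV (scaled_gauss s) >-> R} := mfun_Sub (mem_set idRV).
have C3 : (\int[gauss]_z (Num.max 0 z ^+ 3)%:E)%E \is a fin_num.
  rewrite ge0_fin_numE ?normal_third_moment_lty //.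
  by apply: integral_ge0 => z _; rewrite lee_fin exprn_ge0 // le_max lexx.
have E3 : (\int[scaled_gauss s]_w (Num.max 0 (X w) ^+ 3)%:E =
   (s ^+ 3 * fine (\int[gauss]_z (Num.max 0 z ^+ 3)%:E))%:E)%E.
  by rewrite [LHS]third_moment_scaled_gauss // [RHS]EFinM fineK.
have E1 : (\int[scaled_gauss s]_w (X w)%:E = 0)%E := mean_scaled_gauss s.
have := tilt_le_moments hf m c0 qc E1 (second_moment_scaled_gauss s) E3 (lexx 0).
rewrite -(@ge0_integral_scaled_gauss _ s (fun x => (h (m + x))%:E)).
- by move=> H; apply: (le_lt_trans H); rewrite ltry.
- by apply/measurable_EFinP; apply: (measurableT_comp mt); exact: measurable_funD.
- by move=> x; rewrite lee_fin.
Qed.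

Lemma tilt_majorant_fin c : 0 <= c -> (forall x, q x <= c) ->
  tilt_majorant \is a fin_num.
Proof.
move=> c0 qc; rewrite ge0_fin_numE; last first.
  by apply: integral_ge0 => z _; rewrite lee_fin addr_ge0.
rewrite /tilt_majorant.
transitivity (\int[gauss]_z ((h (0 + 2 * z))%:E + (h (1 + 2 * z))%:E) < +oo)%E.
  congr (_ < _)%E; apply: eq_integral => z _.
  by rewrite add0r [1 + _]addrC.
rewrite ge0_integralD //; do ?[by move=> z _; rewrite lee_fin|exact: mh_affine].
by rewrite lte_add_pinfty // (integral_tilt_scaled_lty _ _ c0 qc).
Qed.

Lemma heat_tilt_fin c v s : 0 <= c -> (forall x, q x <= c) ->
  heat h v s \is a fin_num.
Proof.
move=> c0 qc; rewrite ge0_fin_numE ?heat_ge0 //.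
by apply: (integral_tilt_scaled_lty _ _ c0 qc); exact: sqrtr_ge0.
Qed.

(** Two bounds on the same family. The first keeps only the jump and serves when f''' is unbounded;
    the second also keeps the Gaussian part and needs its finiteness. *)
Lemma attained_lower (beta b1 x0 a : R) : 0 < b1 -> b1 < beta -> 0 <= x0 ->
  x0 <= a -> 1 <= a -> 2 * b1 <= a ->
  exists2 e, attained beta f e &
    ((b1 * q x0 / 6 * (1 - 3 * x0 / a) + f 0)%:E <= e)%E /\
    forall E0 M, heat h 1 0 = E0%:E -> tilt_majorant = M%:E ->
    ((b1 * q x0 / 6 * (1 - 3 * x0 / a) + E0 + f 0
       - (b1 * E0 + 2 * b1 * M) / a)%:E <= e)%E.
Proof.
move=> b10 b1beta x00 x0a a1 ba.
have a0 : 0 < a by lra.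
have aN0 : a != 0 by rewrite gt_eqF.
have a2 : a <= a ^+ 2 by rewrite ler_eXnr.
have a3 : a <= a ^+ 3 by rewrite ler_eXnr.
have a30 : 0 < a ^+ 3 by rewrite exprn_gt0.
pose p := b1 / a ^+ 3.
have p0 : 0 < p by rewrite divr_gt0.
have p2 : p <= 1 / 2 by rewrite ler_pdivrMr //; lra.
have pa : p <= b1 / a by rewrite ler_pM2l // lef_pV2 // posrE.
have p1N0 : 1 - p != 0 by rewrite gt_eqF //; lra.
pose b := p * a / (1 - p).
have p1 : 0 < 1 - p by lra.
have b0 : 0 <= b by exact: divr_ge0 (mulr_ge0 (ltW p0) (ltW a0)) (ltW p1).
(* Twice [p * a ^+ 2]. Since [b <= a], the jump has variance at most [k], and the Gaussian variance
   [(1 - k) ^+ 2] is at most [1 - k]; also [b <= k], as [heat_shrink] requires. *)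
pose k := 2 * b1 / a.
have k0 : 0 < k by rewrite divr_gt0 // mulr_gt0.
have k1 : k <= 1 by rewrite ler_pdivrMr // mul1r.
have pa2 : 2 * (p * a ^+ 2) = k by rewrite /p /k; field.
have bE : b * (1 - p) = p * a by rewrite /b divfK.
have pa0 : 0 <= p * a by rewrite mulr_ge0 // ltW.
have b2 : b <= 2 * (p * a).
  have p21 : 1 <= 2 * (1 - p) by lra.
  by rewrite ler_pdivrMr //; have := ler_wpM2l pa0 p21; lra.
have bk : b <= k.
  by apply: (le_trans b2); rewrite -pa2; have := ler_wpM2l (ltW p0) a2; lra.
have pab : p * a = (1 - p) * b by rewrite -bE mulrC.
have third : p * a ^+ 3 < beta by rewrite /p divfK // gt_eqF.
have var : p * a ^+ 2 + (1 - p) * b ^+ 2 + (1 - k) ^+ 2 <= 1.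
  have -> : (1 - p) * b ^+ 2 = p * a * b by rewrite pab; ring.
  have ba' : b <= a.
    apply: (le_trans b2); rewrite mulrA -[leRHS]mul1r ler_pM2r //; lra.
  have := ler_wpM2l (mulr_ge0 (ltW p0) (ltW a0)) ba'.
  have := ler_wpM2l (ltW k0) k1.
  by rewrite -pa2; lra.
have p01 : 0 < p < 1 by rewrite p0 /=; lra.
have := attained_jump_gauss hf p01 (ltW a0) b0 pab (sqr_ge0 (1 - k)) var third.
set e := (X in attained _ _ X) => ate; exists e => //.
have ha : b1 * q x0 / 6 * (1 - 3 * x0 / a) <= p * h a.
  have q0 := c3_third_ge0 hf x0.
  have t0 : 0 <= x0 / a by rewrite divr_ge0 // ltW.
  have t1 : x0 / a <= 1 by rewrite ler_pdivrMr // mul1r.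
  (* Bernoulli's inequality, which makes the loss from [x0] linear in 1 / a. *)
  have bern : 1 - 3 * (x0 / a) <= (1 - x0 / a) ^+ 3.
    have -> : (1 - x0 / a) ^+ 3 =
      1 - 3 * (x0 / a) + (x0 / a) ^+ 2 * (3 - x0 / a) by ring.
    by rewrite lerDl mulr_ge0 ?sqr_ge0 //; lra.
  have bq : 0 <= b1 * q x0 / 6 by rewrite divr_ge0 // mulr_ge0 // ltW.
  have := ler_wpM2l bq bern.
  have := ler_wpM2l (ltW p0) (tilt_cubic_growth x00 x0a).
  have -> : p * (q x0 * (a - x0) ^+ 3 / 6) = b1 * q x0 / 6 * (1 - x0 / a) ^+ 3.
    by rewrite /p; field.
  by rewrite mulrA; lra.
have hge y v : 0 <= v -> ((h y)%:E <= heat h v y)%E.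
  move=> v0; apply: le_trans (tilt_le_heat hf y v0); rewrite lee_fin lerDl.
  by rewrite divr_ge0 // mulr_ge0 // (c3_second_ge0 hf).
have jump : ((b1 * q x0 / 6 * (1 - 3 * x0 / a))%:E <=
    p%:E * heat h ((1 - k) ^+ 2) a)%E.
  apply: (@le_trans _ _ (p%:E * (h a)%:E)%E); first by rewrite -EFinM lee_fin.
  by rewrite lee_pmul2l // hge // sqr_ge0.
split.
  rewrite EFinD /e leeD2r // -[leLHS]adde0 leeD //.
  by rewrite mule_ge0 ?heat_ge0 // lee_fin ltW.
move=> E0 M HE HM.
have E00 : 0 <= E0 by rewrite -lee_fin -HE heat_ge0.
have M0 : 0 <= M.
  by rewrite -lee_fin -HM integral_ge0 // => z _; rewrite lee_fin addr_ge0.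
have := heat_shrink k0 k1 b0 bk; rewrite HE HM -!EFinM => shr.
have low : ((E0 - (b1 * E0 + 2 * b1 * M) / a)%:E <=
    (1 - p)%:E * heat h ((1 - k) ^+ 2) (- b)%R)%E.
  have {}shr : (((1 + k) * E0 - k * M)%:E <= heat h ((1 - k) ^+ 2) (- b)%R)%E.
    by rewrite EFinB leeBlDr.
  apply: (@le_trans _ _ ((1 - p)%:E * ((1 + k) * E0 - k * M)%:E)%E); last first.
    by rewrite lee_pmul2l.
  rewrite -EFinM lee_fin.
  have -> : (b1 * E0 + 2 * b1 * M) / a = b1 / a * E0 + k * M by rewrite /k; field.
  have := ler_wpM2r E00 pa.
  have := mulr_ge0 (mulr_ge0 (ltW p1) (ltW k0)) E00.
  have := mulr_ge0 (ltW p0) (mulr_ge0 (ltW k0) M0).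
  lra.
rewrite (_ : _ - _ / a = b1 * q x0 / 6 * (1 - 3 * x0 / a) +
  (E0 - (b1 * E0 + 2 * b1 * M) / a) + f 0); last by ring.
by rewrite !EFinD -EFinD /e leeD2r // leeD.
Qed.

End lower_estimates.

(** * Choice of the parameters *)

Section limits.
Context (R : realType) (f f1 f2 q : R -> R) (hf : convex3 f f1 f2 q).

Lemma expectation_standard_normal (d : measure_display) (T : measurableType d)
    (P : probability T R) (Z : {RV P >-> R}) : standard_normal Z ->
  ('E_P[fun w => f (Z w)] = heat (tilt f f1) 1 0 + (f 0)%:E)%E.
Proof.
move=> hZ; have mt := measurable_tilt hf.
have law A : measurable A -> P (Z @^-1` A) = scaled_gauss 1 A.
  move=> mA; apply: etrans (hZ A mA) _.
  rewrite /scaled_gauss /distribution /pushforward /=; congr (normal_prob _ _ _).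
  by apply/seteqP; split => x /=; rewrite mul1r.
have m1 : measurable_fun [set: R] (fun x : R => x%:E) by exact/measurable_EFinP.
have m2 : measurable_fun [set: R] (fun x : R => (x ^+ 2)%:E).
  by apply/measurable_EFinP; exact: exprn_measurable.
have mtE : measurable_fun [set: R] (fun x : R => (tilt f f1 x)%:E).
  exact/measurable_EFinP.
have iZ : P.-integrable setT (EFin \o Z).
  apply: integrable_of_sqr.
  by rewrite (integral_law law m2) second_moment_scaled_gauss ltry.
have EZ : (\int[P]_w (Z w)%:E = 0%:E)%E.
  by rewrite (integral_law law m1) mean_scaled_gauss.
rewrite (expectation_tilt hf (measurable_funP Z) iZ EZ) mulr0 addr0.
congr (_ + _)%E; rewrite (integral_law law mtE) ge0_integral_scaled_gauss //.
  by apply: eq_integral => z _; rewrite sqrtr1 add0r.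
by move=> x; rewrite lee_fin (tilt_ge0 hf).
Qed.

Lemma attained_unbounded (beta r : R) : 0 < beta ->
  (forall r, exists2 x, 0 <= x & r < q x) ->
  exists2 e, attained beta f e & (r%:E <= e)%E.
Proof.
(* With [b1 = beta / 2] and [a >= 6 * x0] the factor [1 - 3 * x0 / a] is at least 1 / 2, so the jump
   contributes at least [beta * q x0 / 24]. *)
move=> b0 large; have [x0 x00 qx0] := large (24 * (`|r| + `|f 0|) / beta).
have b10 : 0 < beta / 2 by lra.
have b1b : beta / 2 < beta by lra.
pose a := 1 + beta + 6 * x0.
have a0 : 0 < a by rewrite /a; lra.
have x0a : x0 <= a by rewrite /a; lra.
have a1 : 1 <= a by rewrite /a; lra.
have ba : 2 * (beta / 2) <= a by rewrite /a; lra.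
have [e ate [le _]] := attained_lower hf b10 b1b x00 x0a a1 ba.
exists e => //; apply: le_trans le; rewrite lee_fin.
move: qx0; rewrite ltr_pdivrMr // => qx0.
have q0 := c3_third_ge0 hf x0.
have half : 1 / 2 <= 1 - 3 * x0 / a.
  have : 3 * x0 / a <= 1 / 2 by rewrite ler_pdivrMr // /a; lra.
  by lra.
have bq : 0 <= beta / 2 * q x0 / 6 by rewrite divr_ge0 // mulr_ge0 // ltW.
have := ler_wpM2l bq half.
have := ler_norm r; have := ler_norm (- f 0); rewrite normrN.
lra.
Qed.

Lemma attained_near (beta c eps : R) : 0 < beta -> 0 <= c ->
  (forall x, q x <= c) -> (forall r, r < c -> exists2 x, 0 <= x & r < q x) ->
  0 < eps ->
  exists2 e, attained beta f e &
    (heat (tilt f f1) 1 0 + (f 0)%:E + (c / 6 * beta)%:E <= e + eps%:E)%E.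
Proof.
move=> b0 c0 qc sup_q eps0.
have E0E := fineK (heat_tilt_fin hf 1 0 c0 qc).
have ME := fineK (tilt_majorant_fin hf c0 qc).
set E0 := fine _ in E0E; set M := fine _ in ME.
have E00 : 0 <= E0.
  by rewrite fine_ge0 // heat_ge0 // => x; exact: (tilt_ge0 hf).
have M0 : 0 <= M.
  rewrite fine_ge0 // integral_ge0 // => z _.
  by rewrite lee_fin addr_ge0 // (tilt_ge0 hf).
(* Lowering both [beta] (by the factor [1 - eta]) and [c] (by [eta]) costs at most [X * eta] in
   their product. The choice of [eta] below gives [eta <= 1 / 2] and [X * eta <= 3 * eps], which
   after division by 6 is half of [eps]. *)
pose X := beta * (1 + c).
have X0 : 0 < X by rewrite mulr_gt0 //; lra.
have Xe : 0 < X + 6 * eps by lra.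
pose eta := 3 * eps / (X + 6 * eps).
have eta0 : 0 < eta by rewrite divr_gt0 //; lra.
have eta1 : eta <= 1 / 2 by rewrite ler_pdivrMr //; lra.
have Xeta : X * eta <= 3 * eps.
  rewrite /eta mulrA ler_pdivrMr // mulrC ler_pM2l; lra.
have [x0 x00 qx0] := sup_q (c - eta) ltac:(lra).
have q0 := c3_third_ge0 hf x0.
pose b1 := beta * (1 - eta).
have b10 : 0 < b1 by rewrite mulr_gt0 //; lra.
have b1b : b1 < beta by rewrite /b1 mulrBr mulr1 ltrBlDr ltrDl mulr_gt0.
(* The terms of [attained_lower] that depend on [a] add up to exactly [- D / a]; [a] is taken large
   enough for this to use at most the other half of [eps]. *)
pose D := b1 * q x0 * x0 / 2 + b1 * E0 + 2 * b1 * M.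
have D0 : 0 <= D.
  have b1' := ltW b10; apply: addr_ge0; last by rewrite mulr_ge0 // mulr_ge0.
  apply: addr_ge0; last exact: mulr_ge0.
  by rewrite divr_ge0 // mulr_ge0 // mulr_ge0.
have De : 0 <= 2 * D / eps by apply: divr_ge0 (ltW eps0); rewrite mulr_ge0.
pose a := 1 + 2 * b1 + x0 + 2 * D / eps.
have a0 : 0 < a by rewrite /a; lra.
have x0a : x0 <= a by rewrite /a; lra.
have a1 : 1 <= a by rewrite /a; lra.
have ba : 2 * b1 <= a by rewrite /a; lra.
have Da : D / a <= eps / 2.
  rewrite ler_pdivrMr //; have : 2 * D / eps <= a by rewrite /a; lra.
  by rewrite ler_pdivrMr // ; lra.
have [e ate [_ le]] := attained_lower hf b10 b1b x00 x0a a1 ba.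
exists e => //; have {}le := le _ _ (esym E0E) (esym ME).
rewrite -E0E -!EFinD.
apply: le_trans (leeD2r eps%:E le); rewrite -EFinD lee_fin.
have bq : b1 * q x0 >= beta * c - X * eta.
  have H : b1 * (c - eta) <= b1 * q x0 by rewrite ler_pM2l // ltW.
  apply: le_trans H; rewrite /b1 /X.
  have := mulr_ge0 (ltW b0) (sqr_ge0 eta); lra.
have -> : b1 * q x0 / 6 * (1 - 3 * x0 / a) + E0 + f 0 - (b1 * E0 + 2 * b1 * M) / a
  = b1 * q x0 / 6 + E0 + f 0 - D / a by rewrite /D; field; rewrite gt_eqF.
lra.
Qed.

End limits.

Theorem theorem1 (R : realType) (beta : R) (hbeta : 0 < beta)
    (f : R -> R) (hf : classF3 f)
    (dZ : measure_display) (TZ : measurableType dZ) (PZ : probability TZ R)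
    (Z : {RV PZ >-> R}) (hZ : standard_normal Z) :
  let bound : \bar R :=
    ('E_PZ[fun w => f (Z w)] + f'''_at_infty f * (3`!%:R^-1)%:E * beta%:E)%E in
  (forall (n : nat) (d : measure_display) (T : measurableType d)
     (P : probability T R) (X : 'I_n -> {RV P >-> R}),
     (0 < n)%N -> admissible beta X ->
     ('E_P[fun w => f (\sum_(i < n) X i w)%R] <= bound)%E) /\
  bound = ereal_sup [set e : \bar R |
    exists (n : nat) (d : measure_display) (T : measurableType d)
      (P : probability T R) (X : 'I_n -> {RV P >-> R}),
      [/\ (0 < n)%N, admissible beta X &
          e = 'E_P[fun w => f (\sum_(i < n) X i w)%R]%E]].
Proof.
have [f1 [f2 [q [c3 q_le q_gt]]]] := classF3_convex3 hf.
move=> bound.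
have tp := tilt_ge0 c3.
have boundE : bound = (heat (tilt f f1) 1 0 + (f 0)%:E +
    f'''_at_infty f * (3`!%:R^-1)%:E * beta%:E)%E.
  by rewrite /bound (expectation_standard_normal c3 hZ).
suff [ub lb] : (forall (n : nat) (d : measure_display) (T : measurableType d)
     (P : probability T R) (X : 'I_n -> {RV P >-> R}),
     (0 < n)%N -> admissible beta X ->
     ('E_P[fun w => f (\sum_(i < n) X i w)%R] <= bound)%E) /\
    (bound <= ereal_sup [set e | attained beta f e])%E.
  split=> //; apply/eqP; rewrite eq_le; apply/andP; split; first exact: lb.
  apply: ge_ereal_sup => _ [n [d [T [P [X [n0 adm ->]]]]]].
  exact: ub.
have third0 : (0 <= f'''_at_infty f)%E.
  by apply: le_trans (q_le 0); rewrite lee_fin (c3_third_ge0 c3).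
move: boundE q_le q_gt third0; clearbody bound.
(* A finite limit [c] bounds [q] and is approached by it; an infinite limit makes the bound +oo, so
   only unboundedness of the supremum remains; -oo is excluded by [third0]. *)
case: (f'''_at_infty f) => [c| |//] boundE q_le q_gt third0.
- have c0 : 0 <= c by rewrite -lee_fin.
  have qc x : q x <= c by rewrite -lee_fin.
  have {}boundE : bound = (heat (tilt f f1) 1 0 + (f 0)%:E + (c / 6 * beta)%:E)%E.
    by rewrite boundE -!EFinM.
  rewrite {}boundE; split=> [n d T P X _ adm|].
    exact: (upper_bound c3).
  apply/lee_addgt0Pr => eps eps0.
  have [|e ate ele] := attained_near c3 hbeta c0 qc _ eps0.
    by move=> r rc; apply: q_gt; rewrite lte_fin.
  by apply: (le_trans ele); rewrite leeD2r // ereal_sup_ubound.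
- have {}boundE : bound = +oo%E.
    rewrite boundE gt0_mulye ?lte_fin ?invr_gt0 ?ltr0n // gt0_mulye ?lte_fin //.
    rewrite addey // gt_eqF // (lt_le_trans (ltNyr (f 0))) //.
    by rewrite leeDr // heat_ge0.
  rewrite {}boundE; split=> [n d T P X _ _|]; first exact: leey.
  rewrite leye_eq; apply/eqP/eq_infty => r.
  have [|e ate re] := attained_unbounded c3 r hbeta.
    by move=> s; apply: q_gt; exact: ltry.
  by apply: (le_trans re); exact: ereal_sup_ubound.
Qed.
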